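(* Let $M^*=\bar U\bar V^\top$ for some pair $(\bar U,\bar V)\in\mathcal M(r,B)$, where $r\ge 1$ and $B>0$. Let $\alpha\in(0,1)$, and let $\pi_{n,\alpha}$ be the fractional posterior built from the low-rank factorization prior with hyperparameters $a,b>0$. Then there is a constant $C_{a,B}$, depending only on $a$ and $B$, such that, setting $$\varepsilon_n = C_{a,B}\,\frac{r(d_1+d_2)\log(nd_1d_2)}{n},$$ there is a small enough $b>0$ for which $$\mathbb{E}\left[\int D_\alpha(P_M,P_{M^*})\,\pi_{n,\alpha}(\mathrm dM)\right]\le \frac{1+\alpha}{1-\alpha}\,\varepsilon_n .$$ Specifically, the result holds for the choice $b=B^2/[512\,(nd_1d_2)^4K^2\max(d_1,d_2)^2]$.
   Context: Model (1-bit matrix completion). Let $f(x)=e^x/(1+e^x)$ and let $\Pi$ be a fixed probability distribution on $[d_1]\times[d_2]$, where $[m]=\{1,\dots,m\}$. For $M\in\mathbb R^{d_1\times d_2}$, $P_M$ denotes the joint distribution of a pair $(\omega,Y)\in([d_1]\times[d_2])\times\{-1,+1\}$ with $\omega\sim\Pi$ and, given $\omega$, $Y=1$ with probability $f(M_\omega)$ and $Y=-1$ with probability $1-f(M_\omega)$. The data $(\omega_1,Y_1),\dots,(\omega_n,Y_n)$ are i.i.d. from $P_{M^*}$ with $M^*\in\mathbb R^{d_1\times d_2}$; $\mathbb E$ and $\mathbb P$ refer to the law of this sample. Fractional posterior. The likelihood is $L_n(M)=\prod_{s=1}^n f(M_{\omega_s})^{\mathbf 1[Y_s=1]}(1-f(M_{\omega_s}))^{\mathbf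 1[Y_s=-1]}$. For $\alpha\in(0,1)$ and a prior $\pi$ on matrices, $\pi_{n,\alpha}(\mathrm dM)\propto L_n(M)^\alpha\,\pi(\mathrm dM)$. Low-rank factorization prior. Fix $K\in\{1,\dots,\min(d_1,d_2)\}$. The prior $\pi$ is the law of $M=LR^\top$, $L\in\mathbb R^{d_1\times K}$, $R\in\mathbb R^{d_2\times K}$, where $\gamma_1,\dots,\gamma_K$ are i.i.d. from $\pi^\gamma$ and, given $\gamma=(\gamma_1,\dots,\gamma_K)$, all rows $L_{i,\cdot}$ ($i\in[d_1]$) and $R_{j,\cdot}$ ($j\in[d_2]$) are i.i.d. $\mathcal N(0,\mathrm{diag}(\gamma))$. Here $\pi^\gamma$ is either the Gamma distribution $\Gamma(a,b)$ (density $\propto x^{a-1}e^{-bx}$ on $x>0$) or the inverse-Gamma distribution $\Gamma^{-1}(a,b)$ (density $\propto x^{-a-1}e^{-b/x}$ on $x>0$), with $a>0$ a fixed constant and $b>0$ a tuning parameter. Class $\mathcal M(r,B)$. For $1\le r\le K$ and $B>0$, $\mathcal M(r,B)$ is the set of pairs $(\bar U,\bar V)$ of matrices of dimensions $d_1\times K$ and $d_2\times K$ with $\|\bar U\|_\infty\le B$, $\|\bar V\|_\infty\le B$ (maximum absolute entry), and $\bar U_{i,\ell}=0$, $\bar V_{j,\ell}=0$ for all $i,j$ whenever $\ell>r$. Rényi divergence. For $\alpha\in(0,1)$, $D_\alpha(Q,R)=\frac1{\alpha-1}\log\int\left(\frac{\mathrm dQ}{\mathrm d\mu}\right)^\alpha\left(\frac{\mathrm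 dR}{\mathrm d\mu}\right)^{1-\alpha}\mathrm d\mu$ for any $\mu$ dominating $Q$ and $R$.
   Formalization: The case n = d_1 = d_2 = 1 is excluded (n d_1 d_2 > 1 is assumed): there log(n d_1 d_2) = 0, so ε_n = 0 and the claimed bound would force the expected divergence to vanish, which is false since M differs from M^* almost surely. *)

(* Defs.v *)
From HB Require Import structures.
From mathcomp Require Import all_boot all_order all_algebra.
From mathcomp Require Import all_classical all_reals all_analysis.
From mathcomp Require Import measurable_realfun.
Import Order.TTheory GRing.Theory Num.Theory.
Import numFieldNormedType.Exports.

Set Implicit Arguments.
Unset Strict Implicit.
Unset Printing Implicit Defensive.

Local Open Scope classical_set_scope.
Local Open Scope ring_scope.

(* Matrices carry the product sigma-algebra, generated by the entries. *)
Definition mx_display : measure_display -> measure_display.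
Proof. exact. Qed.

Section measurable_matrix.
Context {d : measure_display} {T : measurableType d} (m n : nat).

Definition mx_measurable : set (set 'M[T]_(m, n)) :=
  <<s [set A | exists i j (X : set T),
         measurable X /\ A = [set M : 'M[T]_(m, n) | X (M i j)]] >>.

Let mx_set0 : mx_measurable set0.
Proof. exact: sigma_algebra0. Qed.

Let mx_setC A : mx_measurable A -> mx_measurable (~` A).
Proof. exact: sigma_algebraC. Qed.

Let mx_bigcup (F : _^nat) :
  (forall i, mx_measurable (F i)) -> mx_measurable (\bigcup_i F i).
Proof. exact: sigma_algebra_bigcup. Qed.

HB.instance Definition _ := @isMeasurable.Build (mx_display d)
  'M[T]_(m, n) mx_measurable mx_set0 mx_setC mx_bigcup.

Lemma measurable_mx_entry (i : 'I_m) (j : 'I_n) :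
  measurable_fun [set: 'M[T]_(m, n)] (fun M : 'M[T]_(m, n) => M i j).
Proof.
move=> _ X mX; rewrite setTI; apply: sub_sigma_algebra.
by exists i, j, X.
Qed.

End measurable_matrix.

Section density.
Context (d : measure_display) (T : measurableType d) (R : realType).
Variables (mu : {measure set T -> \bar R}) (h : T -> R).
Hypotheses (mh : measurable_fun [set: T] h) (h0 : forall x, 0 <= h x).

(* The measure [h(x) mu(dx)]; the proofs are arguments so that the measure
   instance can be attached. *)
Definition mdensity of measurable_fun [set: T] h & (forall x, 0 <= h x) :=
  fun A : set T => (\int[mu]_(x in A) (h x)%:E)%E.

Let mdensity0 : mdensity mh h0 set0 = 0%E.
Proof. by rewrite /mdensity integral_set0. Qed.

Let mdensity_ge0 A : (0 <= mdensity mh h0 A)%E.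
Proof. by apply: integral_ge0 => x _; rewrite lee_fin. Qed.

Let mdensity_sigma_additive : semi_sigma_additive (mdensity mh h0).
Proof.
apply: semi_sigma_additive_nng_induced => [|x]; last by rewrite lee_fin.
exact/measurable_EFinP.
Qed.

HB.instance Definition _ := isMeasure.Build _ _ _ (mdensity mh h0)
  mdensity0 mdensity_ge0 mdensity_sigma_additive.

End density.

(* The probability measure proportional to [h(x) mu(dx)]. [P0] is the value that
   [mnormalize] returns when the total mass is 0 or +oo; this does not happen in
   the uses below. *)
Definition proportional (d : measure_display) (T : measurableType d)
    (R : realType) (mu : {measure set T -> \bar R}) (h : T -> R)
    (mh : measurable_fun [set: T] h) (h0 : forall x, 0 <= h x)
    (P0 : probability T R) : probability T R :=
  mnormalize (mdensity mu mh h0) P0.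

Section hyperprior.
Context {R : realType}.

Inductive hyper_family := GammaPrior | InverseGammaPrior.

Definition hyper_fun (fam : hyper_family) (a b x : R) : R :=
  match fam with
  | GammaPrior => x `^ (a - 1) * expR (- (b * x))
  | InverseGammaPrior => x `^ (- a - 1) * expR (- (b / x))
  end.

Definition hyper_density fam (a b : R) : R -> R :=
  hyper_fun fam a b \_ `]0, +oo[.

Lemma hyper_density_ge0 fam (a b x : R) : 0 <= hyper_density fam a b x.
Proof.
apply: restrict_ge0 => {}x _.
by case: fam; rewrite /= mulr_ge0 ?powR_ge0 ?expR_ge0.
Qed.

Lemma measurable_hyper_density fam (a b : R) :
  measurable_fun [set: R] (hyper_density fam a b).
Proof.
apply/measurable_restrict => //; rewrite setTI.
have mexp (u : R -> R) : measurable_fun [set: R] u ->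
    measurable_fun [set: R] (fun x => expR (- (b * u x))).
  move=> mu; apply: measurableT_comp => //; apply: measurableT_comp => //.
  exact: measurable_funM.
case: fam; first by apply/measurable_funTS/measurable_funM => //; exact: mexp.
apply: (eq_measurable_fun (fun x => x `^ (- a - 1) * expR (- (b * x `^ (- 1))))).
  move=> x; rewrite inE/= in_itv/= andbT => x0.
  by rewrite powR_inv1 ?ltW.
by apply/measurable_funTS/measurable_funM => //; exact: mexp.
Qed.

Definition hyper_prob fam (a b : R) : probability (measurableTypeR R) R :=
  proportional lebesgue_measure (measurable_hyper_density fam a b)
    (hyper_density_ge0 fam a b) (dirac (1 : measurableTypeR R)).

End hyperprior.

Section prior.
Context {R : realType}.

(* [prior] is the law of [L *m Q^T] for some realization [(g, L, Q)] of the
   hierarchical model on a probability space [(W, P)]: the entries of [g] are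
   i.i.d. from [hyper_prob fam a b] and, conditionally on [g], the rows of [L]
   and [Q] are i.i.d. N(0, diag g), that is, the entries [L i k] and [Q j k] are
   independent N(0, g_k). Both requirements are stated on measurable rectangles,
   which determine the joint law. The second parameter of [normal_prob] is the
   standard deviation. *)
Definition is_lowrank_prior (fam : hyper_family) (a b : R) (d1 d2 K : nat)
    (prior : probability 'M[R]_(d1, d2) R) : Prop :=
  exists (d : measure_display) (W : measurableType d) (P : probability W R)
    (g : {RV P >-> 'rV[R]_K})
    (L : {RV P >-> 'M[R]_(d1, K)}) (Q : {RV P >-> 'M[R]_(d2, K)}),
  [/\ (forall G : 'I_K -> set R, (forall k, measurable (G k)) ->
        P [set w | forall k, G k (g w ord0 k)] =
        (\prod_(k < K) fine (hyper_prob fam a b (G k)))%:E),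
      (forall (G : set 'rV[R]_K)
          (S : 'I_d1 -> 'I_K -> set R) (S' : 'I_d2 -> 'I_K -> set R),
        measurable G -> (forall i k, measurable (S i k)) ->
        (forall j k, measurable (S' j k)) ->
        P [set w | [/\ G (g w), forall i k, S i k (L w i k)
                    & forall j k, S' j k (Q w j k)]] =
        (\int[P]_(w in g @^-1` G)
          ((\prod_(i < d1) \prod_(k < K)
              fine (normal_prob 0 (Num.sqrt (g w ord0 k)) (S i k))) *
           (\prod_(j < d2) \prod_(k < K)
              fine (normal_prob 0 (Num.sqrt (g w ord0 k)) (S' j k))))%:E)%E)
    & (forall A, measurable A ->
        prior A = pushforward P (fun w => L w *m (Q w)^T) A)].

End prior.

Section model.
Context {R : realType} (d1 d2 : nat).

Definition sigmoid (x : R) : R := expR x / (1 + expR x).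

(* An observation [(w, y)]; the label +1 is [true] and the label -1 is [false]. *)
Definition obs : finType := ('I_d1 * 'I_d2 * bool)%type.

Definition is_pmf (I : finType) (p : I -> R) : Prop :=
  (forall x, 0 <= p x) /\ \sum_x p x = 1.

(* Conditional probability of the label of [o] given its position. *)
Definition label_prob (M : 'M[R]_(d1, d2)) (o : obs) : R :=
  let p := sigmoid (M o.1.1 o.1.2) in if o.2 then p else 1 - p.

Definition obs_pmf (Pi : 'I_d1 * 'I_d2 -> R) (M : 'M[R]_(d1, d2)) (o : obs) : R :=
  Pi o.1 * label_prob M o.

Definition likelihood (n : nat) (s : n.-tuple obs) (M : 'M[R]_(d1, d2)) : R :=
  \prod_(i < n) label_prob M (tnth s i).

Definition frac_likelihood (alpha : R) (n : nat) (s : n.-tuple obs)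
  (M : 'M[R]_(d1, d2)) : R := likelihood s M `^ alpha.

Lemma frac_likelihood_ge0 alpha n (s : n.-tuple obs) M :
  0 <= frac_likelihood alpha s M.
Proof. exact: powR_ge0. Qed.

Lemma measurable_sigmoid : measurable_fun [set: R] sigmoid.
Proof.
apply: (eq_measurable_fun (fun x => expR x * (1 + expR x) `^ (- 1))).
  by move=> x _; rewrite powR_inv1 // addr_ge0 ?expR_ge0.
apply: measurable_funM => //.
apply: (@measurableT_comp _ _ _ _ _ _ (fun y : R => y `^ (- 1))) => //.
exact: measurable_funD.
Qed.

Lemma measurable_frac_likelihood alpha n (s : n.-tuple obs) :
  measurable_fun [set: 'M[R]_(d1, d2)] (frac_likelihood alpha s).
Proof.
apply: (@measurableT_comp _ _ _ _ _ _ (fun y : R => y `^ alpha)) => //.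
rewrite /likelihood; apply: measurable_prod => i _.
rewrite /label_prob; case: (tnth s i) => -[j k] y /=.
have mjk : measurable_fun [set: 'M[R]_(d1, d2)]
    (fun M : 'M[R]_(d1, d2) => sigmoid (M j k)).
  exact: measurableT_comp measurable_sigmoid (measurable_mx_entry j k).
by case: y => //; apply: measurable_funB.
Qed.

Definition frac_posterior (alpha : R) (prior : probability 'M[R]_(d1, d2) R)
    (n : nat) (s : n.-tuple obs) : probability 'M[R]_(d1, d2) R :=
  proportional prior (measurable_frac_likelihood alpha s)
    (frac_likelihood_ge0 alpha s) prior.

(* Renyi divergence of two distributions on a finite set, given by their
   densities with respect to the counting measure. [lne 0 = -oo], so mutually
   singular distributions are at divergence +oo when [alpha < 1]. *)
Definition renyi (I : finType) (alpha : R) (p q : I -> R) : \bar R :=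
  (((alpha - 1)^-1)%:E * lne (\sum_x p x `^ alpha * q x `^ (1 - alpha))%:E)%E.

(* Expectation, under n i.i.d. observations from [P_Mstar], of the integrated
   divergence; the sample space is finite. *)
Definition expected_risk (alpha : R) (Pi : 'I_d1 * 'I_d2 -> R)
    (Mstar : 'M[R]_(d1, d2)) (prior : probability 'M[R]_(d1, d2) R) (n : nat)
    : \bar R :=
  (\sum_(s : n.-tuple obs)
     (\prod_(i < n) obs_pmf Pi Mstar (tnth s i))%:E *
     \int[frac_posterior alpha prior s]_M
       renyi alpha (obs_pmf Pi M) (obs_pmf Pi Mstar))%E.

(* The class M(r, B); column indices start at 0, so the columns beyond the
   first [r] are those with [r <= k]. *)
Definition bounded_factors (K r : nat) (B : R)
    (U : 'M[R]_(d1, K)) (V : 'M[R]_(d2, K)) : Prop :=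
  [/\ forall i k, `|U i k| <= B, forall j k, `|V j k| <= B,
      forall i (k : 'I_K), (r <= k)%N -> U i k = 0
    & forall j (k : 'I_K), (r <= k)%N -> V j k = 0].

End model.

(* Main.v *)
Require Import Defs.
From HB Require Import structures.
From mathcomp Require Import all_boot all_order all_algebra.
From mathcomp Require Import all_classical all_reals all_analysis.
From mathcomp Require Import measurable_realfun ring lra.
Import Order.TTheory GRing.Theory Num.Theory.
Import numFieldNormedType.Exports.
Set Implicit Arguments.
Unset Strict Implicit.
Unset Printing Implicit Defensive.
Local Open Scope ring_scope.
Local Open Scope classical_set_scope.

(* Write S(M) for the affinity, the sum of p_M^alpha p_Mstar^(1-alpha), so
   that n (1 - alpha) D_alpha(P_M, P_Mstar) = - n ln S(M), and let l_s(M) be the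
   likelihood ratio to the power alpha, with prior mean Z_s. Since the sample is
   i.i.d., the expectation over s of l_s(M) S(M)^(-n) is 1 for every M. The
   tangent inequality u <= e^u Z_s - 1 - ln Z_s with u = - n ln S(M), integrated
   against the posterior l_s(M) prior(dM) / Z_s and averaged over s, therefore
   bounds n (1 - alpha) times the risk by the mean of - ln Z_s. Log-sigmoids are
   1-Lipschitz, so l_s >= e^(- alpha) on A = {M : |M - Mstar|_oo <= 1/n} and
   - ln Z_s <= alpha - ln prior(A).

   It remains to show prior(A) >= N^(- C r (d1 + d2)) with N = n d1 d2. Ask all
   entries of the factors to be within c = 1 / ((2 B + 1) n K) of the truth. In a
   column k <= r, the variance lies in [1, 2] with polynomially small
   probability, and each of the d1 + d2 entries then costs a power of N. In a
   column k > r, the true entries vanish; the variance is below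
   c^2 / (16 (d1 + d2)) with polynomially small probability, and conditionally on
   that all d1 + d2 entries are small with probability at least 1/2. Such a column
   costs a power of N only once, and there are at most K <= d1 + d2 of them. *)

(** * Integrals against measures with a density *)

Section density_integral.
Context (d : measure_display) (T : measurableType d) (R : realType).
Variables (mu : {measure set T -> \bar R}) (h : T -> R).
Hypotheses (mh : measurable_fun [set: T] h) (h0 : forall x, 0 <= h x).
Local Open Scope ereal_scope.

Import HBNNSimple.

Let integral_mdensity_nnsfun (f : {nnsfun T >-> R}) :
  \int[mdensity mu mh h0]_x (f x)%:E = \int[mu]_x ((f x)%:E * (h x)%:E).
Proof.
have mind r : measurable_fun [set: T]
    (fun x => (r * \1_(f @^-1` [set r]) x)%:E).
  exact/measurable_EFinP/measurable_funM.
under [LHS]eq_integral do rewrite fimfunE -fsumEFin//.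
rewrite [LHS]ge0_integral_fsum//; last first.
  by move=> n x _; rewrite /= ?EFinM; exact: nnfun_muleindic_ge0.
under [RHS]eq_integral.
  move=> x _; rewrite fimfunE -fsumEFin// ge0_mule_fsuml; last first.
    by move=> r; rewrite /= ?EFinM; exact: nnfun_muleindic_ge0.
  over.
rewrite [RHS]ge0_integral_fsum//; last 2 first.
- by move=> r; apply: emeasurable_funM => //; exact/measurable_EFinP.
- by move=> n x _; rewrite mule_ge0 ??EFinM ?nnfun_muleindic_ge0 ?lee_fin.
apply: eq_fsbigr => r /set_mem[t _ <-].
under [RHS]eq_integral do rewrite EFinM -muleA.
rewrite [RHS]ge0_integralZl ?lee_fin//; last 2 first.
- by apply: emeasurable_funM; apply/measurable_EFinP.
- by move=> x _; rewrite mule_ge0// lee_fin.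
rewrite integralZl_indic_nnsfun// integral_indic// setIT; congr *%E.
rewrite /= /mdensity integral_mkcond; apply: eq_integral => x _.
rewrite patchE indicE; case: ifPn => _; [by rewrite mul1e|by rewrite mul0e].
Qed.

(** For simple functions the identity follows from linearity and the definition of [mdensity] on
    sets. Monotone convergence along [nnsfun_approx] extends it to nonnegative measurable [f]. *)
Lemma ge0_integral_mdensity (f : T -> \bar R) :
  measurable_fun [set: T] f -> (forall x, 0 <= f x) ->
  \int[mdensity mu mh h0]_x f x = \int[mu]_x (f x * (h x)%:E).
Proof.
move=> mf f0; pose f_ := nnsfun_approx measurableT mf.
transitivity (limn (fun n => \int[mdensity mu mh h0]_x (f_ n x)%:E)).
  rewrite -monotone_convergence//=.
  - apply: eq_integral => x _; apply/esym/cvg_lim => //=.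
    exact: cvg_nnsfun_approx.
  - by move=> n; exact/measurable_EFinP.
  - by move=> n x _; rewrite lee_fin.
  - by move=> x _ a b ab; rewrite lee_fin//; exact/lefP/nd_nnsfun_approx.
under eq_fun do rewrite integral_mdensity_nnsfun.
rewrite -monotone_convergence//=.
- apply: eq_integral => x _; apply/cvg_lim => //.
  by apply: cvgeZr => //; exact: cvg_nnsfun_approx.
- by move=> n; apply: emeasurable_funM; exact/measurable_EFinP.
- by move=> n x _; rewrite mule_ge0 ?lee_fin.
- move=> x _ a b ab; rewrite lee_wpmul2r ?lee_fin//.
  exact/lefP/nd_nnsfun_approx.
Qed.

(** A total mass that is positive and finite rules out the default branch [P0] of [mnormalize]. *)
Lemma proportionalE (P0 : probability T R) (Z : R) : (0 < Z)%R ->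
  \int[mu]_x (h x)%:E = Z%:E ->
  forall A, proportional mu mh h0 P0 A = (\int[mu]_(x in A) (h x)%:E) * Z^-1%:E.
Proof.
move=> Z0 ZE A; rewrite /proportional/= /mnormalize/=.
by rewrite /mdensity ZE eqe gt_eqF.
Qed.

Lemma ge0_integral_proportional (P0 : probability T R) (Z : R)
    (f : T -> \bar R) : (0 < Z)%R ->
  \int[mu]_x (h x)%:E = Z%:E ->
  measurable_fun [set: T] f -> (forall x, 0 <= f x) ->
  \int[proportional mu mh h0 P0]_x f x =
    Z^-1%:E * \int[mu]_x (f x * (h x)%:E).
Proof.
move=> Z0 ZE mf f0; rewrite -ge0_integral_mdensity//.
have Z0' : (0 <= Z^-1)%R by rewrite invr_ge0 ltW.
rewrite -(@ge0_integral_mscale _ _ _ _ _ _ (NngNum Z0'))//.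
apply: eq_measure_integral => A mA _.
by rewrite [RHS]muleC; exact: proportionalE.
Qed.

End density_integral.

(** * The fractional posterior bound *)

Lemma bounded_integrable (d : measure_display) (T : measurableType d)
    (R : realType) (mu : {finite_measure set T -> \bar R}) (f : T -> R) (H : R) :
  measurable_fun [set: T] f -> (forall x, `|f x| <= H) ->
  mu.-integrable [set: T] (EFin \o f).
Proof.
move=> mf fH; apply: measurable_bounded_integrable => //.
  by rewrite ltey_eq fin_num_measure.
by exists H; split; [exact: num_real|] => x Hx y _; exact: le_trans (fH y) (ltW Hx).
Qed.

(** This is [1 + t <= expR t] at [t = x + ln w], which stands in for the Gibbs variational
    formula. *)
Lemma le_expR_tangent (R : realType) (x w : R) : 0 < w ->
  x <= expR x * w - (1 + ln w).
Proof.
move=> w0; have := expR_ge1Dx (x + ln w).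
rewrite expRD lnK ?posrE//; lra.
Qed.

Section fractional_posterior_risk.
Context (d : measure_display) (T : measurableType d) (R : realType).
Variable prior : probability T R.
Local Open Scope ereal_scope.

(** The tangent inequality with [w = Z / c] is integrated against the posterior. The factor [Z] of
    [w] cancels the normalization, so the exponential term becomes an integral against the prior,
    scaled by [c^-1]. *)
Lemma integral_proportional_le (h E : T -> R) (mh : measurable_fun [set: T] h)
    (h0 : forall x, (0 <= h x)%R) (H c Z : R) :
  measurable_fun [set: T] E -> (forall x, (`|E x| <= H)%R) ->
  (0 < c)%R -> (0 < Z)%R -> \int[prior]_x (h x)%:E = Z%:E ->
  \int[proportional prior mh h0 prior]_x (E x)%:E <=
    c^-1%:E * \int[prior]_x (expR (E x) * h x)%:E - (1 + ln (Z / c))%:E.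
Proof.
move=> mE EH c0 Z0 hZ; set post := proportional prior mh h0 prior.
have w0 : (0 < Z / c)%R by rewrite divr_gt0.
have mexpE : measurable_fun [set: T] (fun x => expR (E x)).
  exact: measurableT_comp.
have iexpE : post.-integrable [set: T] (EFin \o (fun x => expR (E x) * (Z / c))%R).
  apply: (@bounded_integrable _ _ _ _ _ (expR H * (Z / c))%R).
    exact: measurable_funM.
  move=> x; rewrite ger0_norm  ?(mulr_ge0 (expR_ge0 _) (ltW w0))//.
  rewrite /= ler_wpM2r ?(ltW w0)//.
  by rewrite ler_expR (le_trans _ (EH x))// ler_norm.
apply: (@le_trans _ _ (\int[post]_x ((expR (E x) * (Z / c))%:E - (1 + ln (Z / c))%:E))%E).
  apply: le_integral => //.
  - exact: bounded_integrable EH.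
  - by apply: integrableB => //; exact: finite_measure_integrable_cst.
  - by move=> x _; rewrite lee_fin le_expR_tangent.
rewrite integralB//; last exact: finite_measure_integrable_cst.
rewrite integral_cst// (_ : _ [set: T] = 1) ?mule1; last exact: probability_setT.
rewrite leeB//.
rewrite (ge0_integral_proportional mh h0 prior Z0 hZ)//; last 2 first.
- by apply/measurable_EFinP; exact: measurable_funM.
- by move=> x; rewrite lee_fin (mulr_ge0 (expR_ge0 _) (ltW w0)).
under eq_integral do rewrite -EFinM mulrAC mulrC EFinM.
rewrite ge0_integralZl//; last 3 first.
- by apply/measurable_EFinP; exact: measurable_funM.
- by move=> x _; rewrite lee_fin mulr_ge0 ?expR_ge0.
- by rewrite lee_fin ltW.
by rewrite muleA -EFinM mulrA mulVf ?mul1r// gt_eqF.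
Qed.

(* The variational bound for fractional posteriors, specialized to the prior
   conditioned on [A]. *)
Lemma fractional_posterior_risk_le (S : finType) (p c : S -> R)
    (l : S -> T -> R) (ml : forall s, measurable_fun [set: T] (l s))
    (l0 : forall s x, (0 <= l s x)%R) (E : T -> R) (A : set T) (H q v : R) :
  (forall s, 0 <= p s)%R -> (\sum_s p s = 1)%R -> (forall s, 0 < c s)%R ->
  (forall s x, l s x <= 1)%R ->
  measurable_fun [set: T] E -> (forall x, (`|E x| <= H)%R) ->
  (forall x, \sum_s p s / c s * l s x * expR (E x) <= 1)%R ->
  measurable A -> (forall s x, A x -> expR (- q) * c s <= l s x)%R ->
  (0 < v)%R -> v%:E <= prior A ->
  \sum_s (p s)%:E * \int[proportional prior (ml s) (l0 s) prior]_x (E x)%:E <=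
    (q - ln v)%:E.
Proof.
move=> p0 p1 c0 l1 mE EH lE mA lA v0 vA.
have iE s : prior.-integrable [set: T] (EFin \o l s).
  by apply: (@bounded_integrable _ _ _ _ _ 1%R) => // x; rewrite ger0_norm.
pose Z s := fine (\int[prior]_x (l s x)%:E).
have ZE s : \int[prior]_x (l s x)%:E = (Z s)%:E.
  by rewrite /Z fineK//; exact: (integrable_fin_num measurableT (iE s)).
(* The evidence [Z s] is bounded below by the part of the integral over [A]. *)
have vZ s : (expR (- q) * c s * v <= Z s)%R.
  rewrite -lee_fin -ZE.
  apply: (@le_trans _ _ (\int[prior]_(x in A) (cst (expR (- q) * c s)%:E) x)).
    rewrite integral_cst// EFinM lee_wpmul2l// lee_fin.
    by rewrite mulr_ge0 ?expR_ge0 ?ltW.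
  apply: (@le_trans _ _ (\int[prior]_(x in A) (l s x)%:E)).
    apply: ge0_le_integral => //.
    - by move=> x _; rewrite lee_fin mulr_ge0 ?expR_ge0 ?ltW.
    - by apply/measurable_EFinP; exact: measurable_funTS.
    - by move=> x Ax; rewrite lee_fin lA.
  apply: ge0_subset_integral => //; first exact/measurable_EFinP.
  by move=> x _; rewrite lee_fin.
have Z0 s : (0 < Z s)%R.
  by apply: lt_le_trans (vZ s); rewrite !mulr_gt0 ?expR_gt0.
have lnZ s : (ln v - q <= ln (Z s / c s))%R.
  rewrite -[leLHS]expRK ler_ln ?posrE ?expR_gt0 ?divr_gt0//.
  by rewrite addrC expRD lnK ?posrE// ler_pdivlMr// mulrAC.
have mEl s : measurable_fun [set: T] (fun x => expR (E x) * l s x)%R.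
  by apply: measurable_funM => //; exact: measurableT_comp.
pose X s := fine (\int[prior]_x (expR (E x) * l s x)%:E).
have XE s : \int[prior]_x (expR (E x) * l s x)%:E = (X s)%:E.
  rewrite /X fineK//; apply: integrable_fin_num => //.
  apply: (@bounded_integrable _ _ _ _ _ (expR H)) => // x.
  rewrite ger0_norm ?mulr_ge0 ?expR_ge0// -[leRHS]mulr1.
  by rewrite ler_pM ?expR_ge0// ler_expR (le_trans _ (EH x))// ler_norm.
(* Exchanging the sum over samples with the prior integral reduces this to the pointwise hypothesis
   [lE], since the prior has mass 1. *)
have sumX : (\sum_s p s / c s * X s <= 1)%R.
  rewrite -lee_fin -sumEFin.
  have pcl0 s x : 0 <= (p s / c s * l s x * expR (E x))%:E.
    by rewrite lee_fin !mulr_ge0 ?expR_ge0// invr_ge0 ltW.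
  have mpcl s : measurable_fun [set: T]
      (fun x => (p s / c s * l s x * expR (E x))%:E).
    apply/measurable_EFinP; apply: measurable_funM; last exact: measurableT_comp.
    exact: measurable_funM.
  apply: (@le_trans _ _
      (\int[prior]_x (\sum_s (p s / c s * l s x * expR (E x))%:E))%E).
    rewrite ge0_integral_sum//; apply: lee_sum => s _.
    rewrite EFinM -XE -ge0_integralZl//; last 3 first.
    - exact/measurable_EFinP.
    - by move=> x _; rewrite lee_fin mulr_ge0 ?expR_ge0.
    - by rewrite lee_fin divr_ge0// ltW.
    by under [leRHS]eq_integral do rewrite -mulrA [X in (_ * X)%R]mulrC EFinM.
  apply: (@le_trans _ _ (\int[prior]_x (cst 1%:E) x)).
    apply: ge0_le_integral => //.
    - by move=> x _; exact: sume_ge0.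
    - exact: emeasurable_sum.
    - by move=> x _; rewrite sumEFin lee_fin.
  by rewrite integral_cst//= probability_setT mule1.
(* After averaging, the 1 from [sumX] cancels the 1 of the tangent inequality and leaves
   [q - ln v]. *)
apply: (@le_trans _ _ (\sum_s ((p s)%:E * ((c s)^-1 * X s - (1 + (ln v - q)))%:E))%E).
  apply: lee_sum => s _; apply: lee_wpmul2l; first by rewrite lee_fin.
  apply: (le_trans (integral_proportional_le (ml s) (l0 s) mE EH (c0 s) (Z0 s) (ZE s))).
  by rewrite XE -EFinM -EFinB lee_fin lerB// lerD2l.
under eq_bigr do rewrite -EFinM.
rewrite sumEFin lee_fin.
under eq_bigr do rewrite mulrBr mulrA.
by rewrite sumrB -mulr_suml p1 mul1r; lra.
Qed.

End fractional_posterior_risk.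

(** * Logistic observations *)

(** Independence in finite form: distributivity over functions from ['I_n], reindexed by tuples. *)
Lemma sum_tuple_prod (R : comPzRingType) (I : finType) (n : nat) (F : I -> R) :
  \sum_(s : n.-tuple I) \prod_(i < n) F (tnth s i) = (\sum_x F x) ^+ n.
Proof.
rewrite -[in RHS](card_ord n) -prodr_const bigA_distr_bigA/=.
rewrite (reindex (fun f : {ffun 'I_n -> I} => [tuple f i | i < n])) /=; last first.
  exists (fun s : n.-tuple I => [ffun i => tnth s i]) => [f _|s _].
    by apply/ffunP => i; rewrite ffunE tnth_mktuple.
  by apply: eq_from_tnth => i; rewrite tnth_mktuple ffunE.
by apply: eq_bigr => f _; apply: eq_bigr => i _; rewrite tnth_mktuple.
Qed.

Lemma powR_prod (R : realType) (I : Type) (r : seq I) (F : I -> R) (p : R) :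
  (forall i, 0 <= F i) ->
  (\prod_(i <- r) F i) `^ p = \prod_(i <- r) F i `^ p.
Proof.
move=> F0; elim: r => [|x r ih]; first by rewrite !big_nil powR1.
by rewrite !big_cons powRM ?prodr_ge0// ih.
Qed.

Section label_probability.
Context (R : realType) (d1 d2 : nat).
Implicit Types (M : 'M[R]_(d1, d2)) (x y : R) (o : obs d1 d2).

Lemma onem_sigmoid x : 1 - sigmoid x = sigmoid (- x).
Proof.
have e0 := expR_gt0 x; rewrite /sigmoid expRN.
field; rewrite !gt_eqF// ?addr_gt0//.
Qed.

Lemma sigmoid_gt0 x : 0 < sigmoid x.
Proof. by rewrite divr_gt0 ?addr_gt0 ?expR_gt0. Qed.

(** This is the 1-Lipschitz property of the log-sigmoid. After clearing denominators, the linear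
    terms compare by [yx] and the common term [expR x * expR y] by [expR (- e) <= 1]. *)
Lemma sigmoid_ratio x y e : `|x - y| <= e -> expR (- e) * sigmoid y <= sigmoid x.
Proof.
move=> xye; have e0 : 0 <= e := le_trans (normr_ge0 _) xye.
have yx : expR (- e) * expR y <= expR x.
  by rewrite -expRD ler_expR; move: xye; rewrite ler_norml; lra.
have e1 : expR (- e) <= 1 by rewrite expR_le1; lra.
have [x0 y0] := (expR_gt0 x, expR_gt0 y).
rewrite /sigmoid mulrA ler_pdivrMr ?addr_gt0// mulrAC.
rewrite ler_pdivlMr ?addr_gt0//.
have : expR (- e) * (expR x * expR y) <= expR x * expR y.
  by rewrite ler_piMl// mulr_ge0// ltW.
lra.
Qed.

(** The symmetry [1 - sigmoid x = sigmoid (- x)] lets both labels be treated by a single formula. *)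
Lemma label_probE M o :
  label_prob M o = sigmoid ((-1) ^+ (~~ o.2) * M o.1.1 o.1.2).
Proof.
rewrite /label_prob; case: o.2; first by rewrite expr0 mul1r.
by rewrite expr1 mulN1r onem_sigmoid.
Qed.

Lemma label_prob_gt0 M o : 0 < label_prob M o.
Proof. by rewrite label_probE sigmoid_gt0. Qed.

Lemma label_prob_le1 M o : label_prob M o <= 1.
Proof.
by rewrite label_probE -subr_ge0 onem_sigmoid ltW// sigmoid_gt0.
Qed.

Lemma sum_label_prob M (w : 'I_d1 * 'I_d2) :
  label_prob M (w, true) + label_prob M (w, false) = 1.
Proof. by rewrite /label_prob/= addrC subrK. Qed.

Lemma label_prob_ratio M M' o e :
  `|M o.1.1 o.1.2 - M' o.1.1 o.1.2| <= e ->
  expR (- e) * label_prob M' o <= label_prob M o.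
Proof.
move=> MM'; rewrite !label_probE sigmoid_ratio// -mulrBr normrM.
by rewrite normrX normrN1 expr1n mul1r.
Qed.

Lemma sum_obs (F : obs d1 d2 -> R) :
  \sum_o F o = \sum_w (F (w, true) + F (w, false)).
Proof.
rewrite (eq_bigr (fun o => F (o.1, o.2))); last by move=> [].
rewrite -(pair_bigA _ (fun w b => F (w, b)))/=.
by apply: eq_bigr => w _; rewrite big_bool.
Qed.

Lemma measurable_label_prob o :
  measurable_fun [set: 'M[R]_(d1, d2)] (fun M => label_prob M o).
Proof.
have mo : measurable_fun [set: 'M[R]_(d1, d2)]
    (fun M : 'M[R]_(d1, d2) => sigmoid (M o.1.1 o.1.2)).
  exact: measurableT_comp measurable_sigmoid (measurable_mx_entry _ _).
by rewrite /label_prob; case: o.2 => //; exact: measurable_funB.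
Qed.

End label_probability.

(** * Affinity between observation laws and the expected risk *)

Section affinity.
Context (R : realType) (d1 d2 : nat) (Pi : 'I_d1 * 'I_d2 -> R) (alpha : R).
Hypotheses (Pi_pmf : is_pmf Pi) (alpha01 : 0 < alpha < 1).
Variable Mstar : 'M[R]_(d1, d2).
Implicit Types (M : 'M[R]_(d1, d2)) (o : obs d1 d2).

Let Pi_ge0 w : 0 <= Pi w. Proof. by case: Pi_pmf. Qed.

Lemma sum_obs_pmf M : \sum_o obs_pmf Pi M o = 1.
Proof.
rewrite sum_obs -[RHS](Pi_pmf.2); apply: eq_bigr => w _.
by rewrite /obs_pmf -mulrDr sum_label_prob mulr1.
Qed.

(** The sum inside [renyi], with the powers [alpha] and [1 - alpha] of [Pi] already merged into one
    factor [Pi]. *)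
Definition affinity M : R :=
  \sum_o Pi o.1 * (label_prob M o `^ alpha * label_prob Mstar o `^ (1 - alpha)).

Lemma affinityE M :
  \sum_o obs_pmf Pi M o `^ alpha * obs_pmf Pi Mstar o `^ (1 - alpha) =
  affinity M.
Proof.
apply: eq_bigr => o _; have /andP[a0 a1] := alpha01.
rewrite /obs_pmf !powRM ?(ltW (label_prob_gt0 _ _))// mulrACA -powRD; last first.
  by rewrite addrC subrK oner_eq0.
by rewrite addrC subrK powRr1.
Qed.

Lemma label_prob_powR_le1 M o p : 0 <= p -> label_prob M o `^ p <= 1.
Proof.
move=> p0; rewrite -(powRr0 (label_prob M o)) ger_powR//.
by rewrite label_prob_gt0 label_prob_le1.
Qed.

(** A crude bound: at each position either label contributes at most [Pi]. With [affinity_lb] it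
    makes [ln (affinity M)] bounded in [M], hence integrable. *)
Lemma affinity_le2 M : affinity M <= 2.
Proof.
have /andP[a0 a1] := alpha01.
have -> : 2 = \sum_o Pi (o : obs d1 d2).1 :> R.
  by rewrite sum_obs/= big_split/= (Pi_pmf.2).
apply: ler_sum => o _; rewrite ler_piMr// mulr_ile1 ?powR_ge0//.
- by apply: label_prob_powR_le1; exact: ltW.
- by apply: label_prob_powR_le1; rewrite subr_ge0 ltW.
Qed.

(** Numbers in (0, 1] grow when raised to a power in (0, 1). Each term thus dominates
    [obs_pmf Pi M o * label_prob Mstar o], and the product [m] of all label probabilities under
    [Mstar] lies below each of them. *)
Lemma affinity_lb : exists2 m : R, 0 < m & forall M, m <= affinity M.
Proof.
have /andP[a0 a1] := alpha01.
exists (\prod_o label_prob Mstar o) => [|M].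
  by apply: prodr_gt0 => o _; exact: label_prob_gt0.
set m := \prod_o _.
have ml o : m <= label_prob Mstar o.
  rewrite /m (bigD1 o)//= ler_piMr ?(ltW (label_prob_gt0 _ _))//.
  apply: prodr_ile1 => o' _.
  by rewrite (ltW (label_prob_gt0 _ _)) label_prob_le1.
have -> : m = \sum_o obs_pmf Pi M o * m by rewrite -mulr_suml sum_obs_pmf mul1r.
apply: ler_sum => o _; rewrite /obs_pmf -mulrA ler_wpM2l//.
have m0 : 0 <= m by apply: prodr_ge0 => o' _; exact/ltW/label_prob_gt0.
apply: ler_pM => //; first exact/ltW/label_prob_gt0.
- rewrite ger1_powR ?label_prob_gt0 ?label_prob_le1//; exact: ltW.
- apply: (le_trans (ml o)).
  rewrite ger1_powR ?label_prob_gt0 ?label_prob_le1//; lra.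
Qed.

Lemma affinity_gt0 M : 0 < affinity M.
Proof. by have [m m0 mM] := affinity_lb; exact: lt_le_trans (mM M). Qed.

Lemma measurable_affinity : measurable_fun [set: 'M[R]_(d1, d2)] affinity.
Proof.
apply: measurable_sum => o; apply: measurable_funM => //.
apply: measurable_funM => //.
apply: (@measurableT_comp _ _ _ _ _ _ (fun y : R => y `^ alpha)) => //.
exact: measurable_label_prob.
Qed.

(** Positivity of the affinity excludes [lne 0 = -oo], so the divergence is a real number. *)
Lemma renyiE M :
  renyi alpha (obs_pmf Pi M) (obs_pmf Pi Mstar) =
  (- ln (affinity M) / (1 - alpha))%:E.
Proof.
have /andP[a0 a1] := alpha01.
rewrite /renyi affinityE lne_EFin ?affinity_gt0// -EFinM; congr EFin.
field; lra.
Qed.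

(** The summand factors over the observations, and dividing [label_prob Mstar] by its power [alpha]
    leaves the power [1 - alpha] in each factor. *)
Lemma affinity_pow n M :
  \sum_(s : n.-tuple (obs d1 d2)) \prod_(i < n) obs_pmf Pi Mstar (tnth s i) /
    frac_likelihood alpha s Mstar * frac_likelihood alpha s M = affinity M ^+ n.
Proof.
rewrite /affinity -sum_tuple_prod; apply: eq_bigr => s _.
rewrite /frac_likelihood /likelihood !powR_prod;
  try by move=> i; exact/ltW/label_prob_gt0.
rewrite -prodfV -!big_split/=; apply: eq_bigr => i _.
rewrite powRB; last first.
  by rewrite (gt_eqF (label_prob_gt0 _ _)) implybT.
by rewrite powRr1 ?(ltW (label_prob_gt0 _ _))// /obs_pmf; ring.
Qed.

Lemma expected_risk_le n (prior : probability 'M[R]_(d1, d2) R) (v : R) :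
  (0 < n)%N -> 0 < v ->
  (v%:E <= prior [set M : 'M[R]_(d1, d2) |
     forall i j, (`|M i j - Mstar i j| <= n%:R^-1)%R])%E ->
  (expected_risk alpha Pi Mstar prior n <=
     ((alpha - ln v) / (n%:R * (1 - alpha)))%:E)%E.
Proof.
move=> n0 v0; set A := [set M | _] => vA; have /andP[a0 a1] := alpha01.
have nR : 0 < n%:R :> R by rewrite ltr0n.
pose E M : R := - (n%:R * ln (affinity M)).
have renyi_E M : renyi alpha (obs_pmf Pi M) (obs_pmf Pi Mstar) =
    ((n%:R * (1 - alpha))^-1%:E * (E M)%:E)%E.
  by rewrite renyiE -EFinM; congr EFin; rewrite /E; field; lra.
have mE : measurable_fun [set: 'M[R]_(d1, d2)] E.
  apply: measurableT_comp => //; apply: measurable_funM => //.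
  exact: (measurableT_comp (@measurable_ln R) measurable_affinity).
have [m m0 mS] := affinity_lb.
have EH M : `|E M| <= n%:R * (`|ln m| + ln 2).
  have Sm : ln m <= ln (affinity M) by rewrite ler_ln ?posrE ?affinity_gt0.
  have S2 : ln (affinity M) <= ln 2.
    by rewrite ler_ln ?posrE ?affinity_gt0// affinity_le2.
  have l2 : 0 <= ln 2 :> R by rewrite ln_ge0// ler1n.
  rewrite /E normrN normrM ger0_norm ?ler_wpM2l ?(ltW nR)//.
  have := ler_norm (ln m); have := ler_norm (- ln m).
  by rewrite normrN ler_norml; lra.
have mA : measurable A.
  rewrite (_ : A = \bigcap_(i in [set: 'I_d1]) \bigcap_(j in [set: 'I_d2])
     [set M | `|M i j - Mstar i j| <= n%:R^-1]); last first.
    by apply/seteqP; split => M h i => [_ j _|j]; exact: h.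
  apply: fin_bigcap_measurable => // i _; apply: fin_bigcap_measurable => // j _.
  rewrite [X in measurable X](_ : _ = [set: 'M[R]_(d1, d2)] `&`
      (fun M : 'M[R]_(d1, d2) => M i j) @^-1`
      `[Mstar i j - n%:R^-1, Mstar i j + n%:R^-1]).
    exact: measurable_mx_entry.
  by rewrite setTI; apply/seteqP; split => M /=; rewrite in_itv/= ler_distl.
have lA (s : n.-tuple (obs d1 d2)) M : A M ->
    expR (- alpha) * frac_likelihood alpha s Mstar <= frac_likelihood alpha s M.
  move=> AM; rewrite -[- alpha]mulN1r expRM -powRM ?expR_ge0//; last first.
    by apply: prodr_ge0 => i _; exact/ltW/label_prob_gt0.
  apply: ge0_ler_powR; rewrite ?nnegrE ?(ltW a0)//.
  - by rewrite mulr_ge0 ?expR_ge0// prodr_ge0// => i _; exact/ltW/label_prob_gt0.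
  - by apply: prodr_ge0 => i _; exact/ltW/label_prob_gt0.
  (* The loss [expR (- 1)] is spread over the [n] observations, each paying for an entry deviation
     of at most [1 / n]. *)
  rewrite (_ : expR _ = \prod_(i < n) expR (- n%:R^-1)); last first.
    by rewrite prodr_const card_ord -expRM_natr mulNr mulVf// gt_eqF.
  rewrite -big_split/=; apply: ler_prod => i _.
  by rewrite mulr_ge0 ?expR_ge0 ?(ltW (label_prob_gt0 _ _))// label_prob_ratio.
have post_le : (\sum_(s : n.-tuple (obs d1 d2))
    (\prod_(i < n) obs_pmf Pi Mstar (tnth s i))%:E *
    \int[frac_posterior alpha prior s]_M (E M)%:E <= (alpha - ln v)%:E)%E.
  apply: (@fractional_posterior_risk_le _ _ _ prior _ _
    (fun s => frac_likelihood alpha s Mstar) _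
    (measurable_frac_likelihood alpha (n := n))
    (frac_likelihood_ge0 alpha (n := n)) _ _ _ _ _ _ _ _ _ mE EH _ mA lA v0 vA)
    => [s||s|s M|M].
  - apply: prodr_ge0 => i _.
    by rewrite mulr_ge0// ltW// label_prob_gt0.
  - by rewrite sum_tuple_prod sum_obs_pmf expr1n.
  - by rewrite powR_gt0// prodr_gt0// => i _; exact: label_prob_gt0.
  - have <- : 1 `^ alpha = 1 :> R by rewrite powR1.
    apply: ge0_ler_powR; rewrite ?nnegrE ?(ltW a0)//.
      by apply: prodr_ge0 => i _; exact/ltW/label_prob_gt0.
    apply: prodr_ile1 => i _.
    by rewrite (ltW (label_prob_gt0 _ _)) label_prob_le1.
  (* Here [expR (E M)] is the inverse of [affinity M ^+ n], so the sum is exactly 1. *)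
  - rewrite -mulr_suml.
    rewrite affinity_pow /E expRN expRM_natl lnK ?posrE ?affinity_gt0//.
    by rewrite divff// expf_neq0// gt_eqF ?affinity_gt0.
have n1a : 0 < n%:R * (1 - alpha) by rewrite mulr_gt0// subr_gt0.
have iE (s : n.-tuple (obs d1 d2)) :
    (frac_posterior alpha prior s).-integrable [set: 'M[R]_(d1, d2)] (EFin \o E).
  exact: bounded_integrable EH.
pose X (s : n.-tuple (obs d1 d2)) :=
  fine (\int[frac_posterior alpha prior s]_M (E M)%:E).
have XE s : (\int[frac_posterior alpha prior s]_M (E M)%:E)%E = (X s)%:E.
  by rewrite /X fineK//; exact: (integrable_fin_num measurableT (iE s)).
move: post_le; under eq_bigr do rewrite XE -EFinM.
rewrite sumEFin lee_fin => post_le.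
have renyiX s : (\int[frac_posterior alpha prior s]_M
    renyi alpha (obs_pmf Pi M) (obs_pmf Pi Mstar) =
    ((n%:R * (1 - alpha))^-1 * X s)%:E)%E.
  under eq_integral do rewrite renyi_E.
  by rewrite (integralZl measurableT (iE s)) EFinM -XE.
rewrite /expected_risk; under eq_bigr do rewrite renyiX -EFinM mulrCA.
by rewrite sumEFin lee_fin -mulr_sumr mulrC ler_pM2r ?invr_gt0.
Qed.

End affinity.

(** * Concentration of the factors *)

(** The centered density decreases in [|z|], so its value at [H] bounds it from below on the whole
    interval. *)
Lemma normal_prob_itv_ge (R : realType) (s x y H : R) :
  s != 0 -> x <= y -> (forall z, x <= z <= y -> `|z| <= H) ->
  (y - x) * (normal_peak s * expR (- (H ^+ 2 / (s ^+ 2 *+ 2)))) <=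
  fine (normal_prob 0 s `[x, y]).
Proof.
move=> s0 xy zH; rewrite -lee_fin fineK ?fin_num_measure//.
rewrite /normal_prob; set k := normal_peak s * _.
apply: (@le_trans _ _ (\int[lebesgue_measure]_(z in `[x, y]) (cst k%:E z))%E).
  rewrite integral_cst//= lebesgue_measure_itv/= lte_fin.
  case: ltgtP xy => // [xy|<-] _; first by rewrite -EFinB -EFinM mulrC.
  by rewrite subrr mul0r mule0.
apply: ge0_le_integral => //.
- by move=> z _; rewrite lee_fin mulr_ge0 ?expR_ge0 ?normal_peak_ge0.
- by apply/measurable_EFinP/measurable_funTS; exact: measurable_normal_pdf.
- move=> z /=; rewrite in_itv/= lee_fin normal_pdfE// => /zH zH'.
  rewrite ler_wpM2l ?normal_peak_ge0// ler_expR subr0 mulNr lerN2.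
  rewrite ler_wpM2r ?invr_ge0 ?mulrn_wge0 ?sqr_ge0//.
  have : `|z| ^+ 2 <= H ^+ 2 by rewrite lerXn2r ?nnegrE ?normr_ge0 ?(le_trans _ zH').
  by rewrite real_normK ?num_real.
Qed.

(* On [`|z| > e] the density with deviation [s] is at most
   [2 * expR (- 3 e^2 / 8 s^2)] times the density with deviation [2 s]. *)
Lemma normal_prob_tail_le (R : realType) (s e : R) :
  s != 0 -> 0 < e ->
  (normal_prob 0 s (~` `[(- e)%R, e]) <= (8 * s ^+ 2 / e ^+ 2)%:E)%E.
Proof.
move=> s0 e0; have s20 : 0 < s ^+ 2 by rewrite exprn_even_gt0.
have e20 : 0 < e ^+ 2 by rewrite exprn_gt0.
have s2 : 2 * s != 0 by rewrite mulf_neq0.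
set k := 8 * s ^+ 2 / e ^+ 2.
have k0 : 0 <= k.
  apply: divr_ge0; last exact: ltW.
  by apply: mulr_ge0 => //; exact: ltW.
have mc : measurable (~` `[(- e)%R, e] : set R) by exact: measurableC.
have peak2 : normal_peak s = 2 * normal_peak (2 * s).
  rewrite /normal_peak (_ : (2 * s) ^+ 2 * pi *+ 2 = 2 ^+ 2 * (s ^+ 2 * pi *+ 2)).
    by rewrite sqrtrM// sqrtr_sqr ger0_norm// invfM mulrA divff ?mul1r.
  by rewrite exprMn -mulrA mulrnAr.
apply: (@le_trans _ _ (\int[lebesgue_measure]_(z in ~` `[(- e)%R, e])
    (k%:E * (normal_pdf 0 (2 * s) z)%:E))%E).
  apply: ge0_le_integral => //.
  - by move=> z _; rewrite lee_fin normal_pdf_ge0.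
  - by apply/measurable_EFinP/measurable_funTS; exact: measurable_normal_pdf.
  - apply: emeasurable_funM => //; apply/measurable_EFinP/measurable_funTS.
    exact: measurable_normal_pdf.
  - move=> z /=; rewrite in_itv/= => zc.
    have ze : e ^+ 2 <= z ^+ 2.
      have : e ^+ 2 <= `|z| ^+ 2.
        rewrite lerXn2r ?nnegrE ?(ltW e0)//.
        rewrite leNgt; apply/negP => ze; apply: zc.
        by move: ze; rewrite ltr_norml => /andP[? ?]; rewrite !ltW.
      by rewrite real_normK ?num_real.
    rewrite -EFinM lee_fin !normal_pdfE// peak2 /normal_fun subr0.
    set A := expR (- z ^+ 2 / (s ^+ 2 *+ 2)).
    set B := expR _.
    pose y := 3 / 8 * (z ^+ 2 / s ^+ 2).
    have y0 : 0 < y by rewrite mulr_gt0// divr_gt0// (lt_le_trans e20).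
    have AB : A = B * expR (- y).
      by rewrite /A /B -expRD; congr expR; rewrite /y; field.
    (* Replacing the exponential by [y^-1] gives the ratio [16 s^2 / (3 z^2)], which is at most [k]
       because [16 / 3 <= 8] and [e^2 <= z^2]. *)
    have ey : expR (- y) <= y^-1.
      by rewrite expRN lef_pV2 ?posrE ?expR_gt0//; have := expR_ge1Dx y; lra.
    have yk : 2 * y^-1 <= k.
      rewrite ler_pdivrMr// /k /y.
      have : 1 <= z ^+ 2 / e ^+ 2 by rewrite ler_pdivlMr// mul1r.
      rewrite (_ : 8 * s ^+ 2 / e ^+ 2 * _ = 3 * (z ^+ 2 / e ^+ 2)); last first.
        by field; rewrite s0 gt_eqF.
      lra.
    have P0 : 0 <= normal_peak (2 * s) * B by rewrite mulr_ge0 ?normal_peak_ge0 ?expR_ge0.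
    rewrite AB (_ : _ * (B * _) = normal_peak (2 * s) * B * (2 * expR (- y))).
      by rewrite [leRHS]mulrC ler_wpM2l// (le_trans _ yk)// ler_pM2l.
    by ring.
rewrite ge0_integralZl//; last 2 first.
- by apply/measurable_EFinP/measurable_funTS; exact: measurable_normal_pdf.
- by move=> z _; rewrite lee_fin normal_pdf_ge0.
rewrite -[leRHS]mule1 lee_wpmul2l ?lee_fin//.
exact: (@probability_le1 _ _ _ (normal_prob 0 (2 * s))).
Qed.

Lemma normal_prob_centered_ge (R : realType) (s e : R) :
  s != 0 -> 0 < e ->
  1 - 8 * s ^+ 2 / e ^+ 2 <= fine (normal_prob 0 s `[(- e)%R, e]).
Proof.
move=> s0 e0; have := normal_prob_tail_le s0 e0.
rewrite probability_setC// leeBlDr ?fin_num_measure// -leeBlDl//.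
rewrite -[X in (_ <= X)%E]fineK ?fin_num_measure// lee_fin; lra.
Qed.

(** * Normalizing constant and lower bounds for the hyperprior *)

Section hyperprior_mass.
Context (R : realType).
Notation mu := (@lebesgue_measure R).

(** The primitive is [z^e / e]. The case [e = a] serves near 0 and [e = - a] serves near
    infinity. *)
Lemma integral_powRB1 (e x y : R) : e != 0 -> 0 < x -> x < y ->
  (\int[mu]_(z in `[x, y]) (z `^ (e - 1))%:E = ((y `^ e - x `^ e) / e)%:E)%E.
Proof.
move=> e0 x0 xy.
pose F z := e^-1 * z `^ e.
have dF (z : R) : 0 < z -> is_derive z (1 : R) F (z `^ (e - 1)).
  move=> z0; rewrite -[X in is_derive _ _ _ X](mulKf e0).
  by apply: is_deriveZ; exact: is_derive1_powR.
have cont (p z : R) : 0 < z -> {for z, continuous (fun u : R => u `^ p)}.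
  move=> z0; apply: differentiable_continuous; apply/derivable1_diffP.
  by apply: derivable_powR; rewrite in_itv/= z0.
rewrite (@continuous_FTC2 _ _ F)//.
- by rewrite -EFinB; congr EFin; rewrite /F; field.
- apply: continuous_in_subspaceT => z; rewrite inE/= in_itv/= => /andP[xz _].
  by apply: cont; exact: lt_le_trans xz.
- split.
  + move=> z; rewrite in_itv/= => /andP[xz _].
    by case: (dF _ (lt_trans x0 xz)).
  + apply: cvg_at_right_filter; apply: cvgM; first exact: cvg_cst.
    exact: cont.
  + apply: cvg_at_left_filter; apply: cvgM; first exact: cvg_cst.
    by apply: cont; exact: lt_trans xy.
- move=> z; rewrite in_itv/= => /andP[xz _].
  by rewrite derive1E; case: (dF _ (lt_trans x0 xz)).
Qed.

(** As [y >= 1], the exponent can be raised to [m.+1]; then one term of the exponential series at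
    [b * y] suffices. *)
Lemma powR_expRN_le (b y p : R) (m : nat) : 0 < b -> 1 <= y -> p <= m.+1%:R ->
  y `^ p * expR (- (b * y)) <= m.+1`!%:R / b ^+ m.+1.
Proof.
move=> b0 y1 pm; have y0 : 0 <= y by exact: le_trans y1.
have f0 : 0 < m.+1`!%:R :> R by rewrite ltr0n fact_gt0.
have by0 : 0 <= b * y by rewrite mulr_ge0// ltW.
apply: (@le_trans _ _ (y ^+ m.+1 * expR (- (b * y)))).
  by rewrite ler_wpM2r ?expR_ge0// -powR_mulrn// ler_powR.
rewrite expRN ler_pdivrMr ?expR_gt0// mulrAC ler_pdivlMr ?exprn_gt0//.
rewrite -exprMn [y * b]mulrC -ler_pdivrMl// [leLHS]mulrC.
by apply: le_trans (expR_ge1Dxn m by0); rewrite lerDr.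
Qed.

Section total_mass.
Variables (fam : hyper_family) (a b : R) (m : nat).
Hypotheses (a0 : 0 < a) (b0 : 0 < b) (am : 2 * a <= m.+1%:R).

(** Dominates both 1 and the bound of [powR_expRN_le]. Being polynomial in [b^-1], it costs only a
    power of [n d1 d2] later. *)
Definition hyper_total_bound : R := m.+1`!%:R * (1 + b^-1) ^+ m.+1.

Let D := hyper_total_bound.

Let fact_ge1 : 1 <= m.+1`!%:R :> R.
Proof. by rewrite ler1n fact_gt0. Qed.

Let D_ge1 : 1 <= D.
Proof.
by rewrite /D mulr_ege1// exprn_ege1// lerDl invr_ge0 ltW.
Qed.

Let D_ge : m.+1`!%:R / b ^+ m.+1 <= D.
Proof.
rewrite /D ler_wpM2l// -exprVn lerXn2r ?nnegrE ?addr_ge0 ?invr_ge0 ?(ltW b0)//.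
by rewrite lerDr.
Qed.

(** For the inverse Gamma, the exponents [- a - 1] and [a - 1] differ by [2 * a]; the excess power
    of [x^-1] is absorbed by [expR (- (b / x))]. *)
Lemma hyper_fun_le_near0 (x : R) : 0 < x <= 1 ->
  hyper_fun fam a b x <= D * x `^ (a - 1).
Proof.
move=> /andP[x0 x1]; case: fam => /=.
  rewrite mulrC ler_wpM2r ?powR_ge0// (le_trans _ D_ge1)//.
  by rewrite expR_le1 oppr_le0 mulr_ge0// ltW.
have x1' : 1 <= x^-1 by rewrite invf_ge1.
have xE : x `^ (- a - 1) = x `^ (a - 1) * x^-1 `^ (2 * a).
  rewrite -powR_inv1 ?(ltW x0)// -powRrM -powRD ?(gt_eqF x0) ?implybT//.
  by congr (_ `^ _); ring.
rewrite xE -mulrA mulrC ler_wpM2r ?powR_ge0//.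
by rewrite (le_trans _ D_ge)// powR_expRN_le.
Qed.

(** The mirror image: now the Gamma density has the excess power [2 * a], absorbed by
    [expR (- (b * x))]. *)
Lemma hyper_fun_le_far (x : R) : 1 <= x ->
  hyper_fun fam a b x <= D * x `^ (- a - 1).
Proof.
move=> x1; have x0 : 0 < x by exact: lt_le_trans x1.
case: fam => /=.
  have -> : a - 1 = (- a - 1) + 2 * a by ring.
  rewrite powRD ?(gt_eqF x0) ?implybT// -mulrA mulrC ler_wpM2r ?powR_ge0//.
  by rewrite (le_trans _ D_ge)// powR_expRN_le.
rewrite mulrC ler_wpM2r ?powR_ge0// (le_trans _ D_ge1)//.
by rewrite expR_le1 oppr_le0 divr_ge0// ltW.
Qed.

Lemma measurable_hyper_fun :
  measurable_fun (`]0, +oo[ : set R) (hyper_fun fam a b).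
Proof.
apply: (measurable_restrictT _ _).2 => //; exact: (measurable_hyper_density fam a b).
Qed.

Lemma hyper_fun_ge0 (x : R) : 0 <= hyper_fun fam a b x.
Proof. by case: fam => /=; rewrite mulr_ge0 ?powR_ge0 ?expR_ge0. Qed.

Lemma hyper_itv_le (x y : R) : 0 < x < 1 -> 1 < y ->
  (\int[mu]_(z in `[x, y]) (hyper_fun fam a b z)%:E <= (2 * D / a)%:E)%E.
Proof.
move=> /andP[x0 x1] y1.
have sub (u : bool) (v : R) (w : bool) t : 0 < v ->
    [set` Interval (BSide u v) (BSide w t)] `<=` `]0, +oo[.
  move=> v0 z; rewrite /= !in_itv/= andbT => /andP[vz _].
  by apply: lt_le_trans v0 _; case: u vz => //= /ltW.
have mh (u : bool) (v : R) (w : bool) t : 0 < v ->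
    measurable_fun [set` Interval (BSide u v) (BSide w t)] (EFin \o hyper_fun fam a b).
  move=> v0; apply/measurable_EFinP.
  by apply: (measurable_funS _ (sub u v w t v0)) measurable_hyper_fun.
have mp p (A : set R) : measurable_fun A (fun z : R => (D * z `^ p)%:E).
  by apply/measurable_EFinP/measurable_funTS/measurable_funM.
have D0 : 0 <= D by exact: le_trans D_ge1.
(* Splitting at 1 leaves two power integrals, each contributing at most [D / a]. *)
rewrite (@itv_bndbnd_setU _ _ _ (BRight 1)) ?bnd_simp ?(ltW x1) ?(ltW y1)//.
rewrite ge0_integral_setU//=; last 3 first.
- by rewrite -itv_bndbnd_setU ?bnd_simp ?(ltW x1) ?(ltW y1)//; exact: mh.
- by move=> z _; rewrite lee_fin hyper_fun_ge0.
- apply/disj_setPS => z [] /=; rewrite !in_itv/= => /andP[_ z1] /andP[+ _].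
  by rewrite ltNge z1.
have -> : 2 * D / a = D * a^-1 + D * a^-1 by ring.
rewrite EFinD leeD//.
  apply: (@le_trans _ _ (\int[mu]_(z in `[x, 1%R]) (D%:E * (z `^ (a - 1))%:E))%E).
    apply: ge0_le_integral => //.
    - by move=> z _; rewrite lee_fin hyper_fun_ge0.
    - exact: mh.
    - exact: mp.
    - move=> z /=; rewrite in_itv/= => /andP[xz z1].
      by rewrite -EFinM lee_fin hyper_fun_le_near0// z1 (lt_le_trans x0).
  rewrite ge0_integralZl//; last 2 first.
  - exact/measurable_EFinP/measurable_funTS.
  - by move=> z _; rewrite lee_fin powR_ge0.
  rewrite integral_powRB1 ?gt_eqF// -EFinM lee_fin ler_wpM2l//.
  by rewrite powR1 ler_piMl ?invr_ge0 ?(ltW a0)// lerBlDr lerDl powR_ge0.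
rewrite integral_itv_obnd_cbnd; last exact: mh.
apply: (@le_trans _ _ (\int[mu]_(z in `[1%R, y]) (D%:E * (z `^ (- a - 1))%:E))%E).
  apply: ge0_le_integral => //.
  - by move=> z _; rewrite lee_fin hyper_fun_ge0.
  - exact: mh.
  - exact: mp.
  - move=> z /=; rewrite in_itv/= => /andP[z1 _].
    by rewrite -EFinM lee_fin hyper_fun_le_far.
rewrite ge0_integralZl//; last 2 first.
- exact/measurable_EFinP/measurable_funTS.
- by move=> z _; rewrite lee_fin powR_ge0.
rewrite integral_powRB1 ?oppr_eq0 ?gt_eqF// -EFinM lee_fin ler_wpM2l//.
rewrite powR1 invrN mulrN -mulNr opprB.
by rewrite ler_piMl ?invr_ge0 ?(ltW a0)// lerBlDr lerDl powR_ge0.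
Qed.

Lemma hyper_total_le :
  (\int[mu]_x (hyper_density fam a b x)%:E <= (2 * D / a)%:E)%E.
Proof.
(* The shift by 2 keeps 1 strictly inside every interval, as [hyper_itv_le] requires. *)
pose F (k : nat) : set R := `[k.+2%:R^-1, k.+2%:R].
have F0 k x : F k x -> 0 < x.
  by rewrite /F/= in_itv/= => /andP[kx _]; rewrite (lt_le_trans _ kx)// invr_gt0.
have FU : \bigcup_k F k = `]0, +oo[ :> set R.
  apply/seteqP; split => [x [k _ /F0 x0]|x]; first by rewrite /= in_itv/= x0.
  rewrite /= in_itv/= andbT => x0.
  have xi0 : 0 < x^-1 by rewrite invr_gt0.
  pose k := Num.bound (x + x^-1).
  have kx : x + x^-1 < k%:R by rewrite archi_boundP// addr_ge0// ltW.
  exists k => //; rewrite /F/= in_itv/=; apply/andP; split.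
    rewrite -[leRHS]invrK lef_pV2 ?posrE//.
    by apply: ltW; apply: lt_le_trans (_ : k%:R <= _);
    [lra|rewrite ler_nat -addn2 leq_addr].
  by apply: ltW; apply: lt_le_trans (_ : k%:R <= _);
    [lra|rewrite ler_nat -addn2 leq_addr].
have -> : (\int[mu]_x (hyper_density fam a b x)%:E =
    \int[mu]_(x in \bigcup_k F k) (EFin \o hyper_fun fam a b) x)%E.
  by rewrite FU [RHS]integral_mkcond restrict_EFin.
apply: cvge_le (ge0_nondecreasing_set_cvg_integral _ _ _ _).
- near=> k; apply: hyper_itv_le.
    by rewrite invr_gt0 ltr0n/= invf_lt1 ?ltr0n// ltr1n.
  by rewrite ltr1n.
- move=> i j ij; apply/subsetPset => x; rewrite /F/= !in_itv/= => /andP[ix xi].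
  rewrite (le_trans xi) ?ler_nat// andbT (le_trans _ ix)//.
  by rewrite lef_pV2 ?posrE ?ltr0n// ler_nat.
- by move=> i; exact: measurable_itv.
- move=> i; apply/measurable_EFinP; apply: measurable_funS measurable_hyper_fun => //.
  by move=> x /F0; rewrite /= in_itv/= andbT.
- by move=> i x _; rewrite lee_fin hyper_fun_ge0.
Unshelve. all: end_near. Qed.

End total_mass.

End hyperprior_mass.

Section hyperprior_lower_bound.
Context (R : realType).
Notation mu := (@lebesgue_measure R).

(** One bound covers both families. The power is controlled by [s / 2 <= x <= 2]; the exponent is at
    most [L * s * s <= 4 * L] for the Gamma and at most [2 * L] for the inverse Gamma. *)
Lemma hyper_fun_ge (fam : hyper_family) (a b s L x : R) :
  0 < a -> 0 < b -> 0 < s <= 2 -> b <= L * s -> s / 2 <= x <= s ->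
  expR (- (4 * L)) * (2 `^ (- a) / 2 * (s / 2) `^ a) <= hyper_fun fam a b x.
Proof.
move=> a0 b0 /andP[s0 s2] bL /andP[sx xs].
have h0 : 0 < s / 2 by rewrite divr_gt0.
have x0 : 0 < x := lt_le_trans h0 sx.
have x2 : x <= 2 := le_trans xs s2.
have xi : 2^-1 <= x^-1 by rewrite lef_pV2 ?posrE.
have L0 : 0 < L by rewrite -(pmulr_lgt0 _ s0) (lt_le_trans b0).
have sa1 : (s / 2) `^ a <= 1.
  apply: (@le_trans _ _ (1 `^ a)); last by rewrite powR1.
  by rewrite ge0_ler_powR ?nnegrE ?(ltW a0) ?(ltW h0)//; lra.
have ta1 : 2 `^ (- a) <= 1 :> R 
  by rewrite -[leRHS](powRr0 2) ler_powR ?ler1n// oppr_le0 ltW.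
rewrite mulrC; case: fam => /=; apply: ler_pM;
  rewrite ?mulr_ge0 ?invr_ge0 ?powR_ge0 ?expR_ge0//.
- rewrite powRD ?(gt_eqF x0) ?implybT// powR_inv1 ?(ltW x0)// mulrC.
  rewrite ler_pM ?mulr_ge0 ?invr_ge0 ?powR_ge0//.
    by rewrite ge0_ler_powR ?nnegrE ?(ltW a0) ?(ltW h0) ?(ltW x0).
  by apply: le_trans xi; rewrite ler_piMl.
- rewrite ler_expR lerN2 (@le_trans _ _ (L * s * s))//.
    by rewrite ler_pM// ltW.
  rewrite mulrC; have := ler_pM (ltW s0) (ltW s0) s2 s2.
  by rewrite -subr_ge0 => /(mulr_ge0 (ltW L0)); lra.
- rewrite powRD ?(gt_eqF x0) ?implybT// powR_inv1 ?(ltW x0)//.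
  rewrite (@le_trans _ _ (2 `^ (- a) / 2))//.
    by rewrite ler_piMr ?mulr_ge0 ?powR_ge0.
  rewrite ler_pM ?invr_ge0 ?powR_ge0//.
  rewrite !powRN lef_pV2 ?posrE ?powR_gt0//.
  by rewrite ge0_ler_powR ?nnegrE ?(ltW a0) ?(ltW x0).
- rewrite ler_expR lerN2 ler_pdivrMr// (le_trans bL)//.
  by have := mulr_ge0 (ltW L0) (ltW x0); nra.
Qed.

(** Interval length times the pointwise bound of [hyper_fun_ge], divided by the total mass bound
    [2 * D / a]. *)
Lemma hyper_prob_ge (fam : hyper_family) (a b s L : R) (m : nat) :
  0 < a -> 0 < b -> 0 < s <= 2 -> b <= L * s -> 2 * a <= m.+1%:R ->
  s / 2 * (expR (- (4 * L)) * (2 `^ (- a) / 2 * (s / 2) `^ a)) *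
    (a / (2 * hyper_total_bound b m)) <=
  fine (hyper_prob fam a b `[s / 2, s]).
Proof.
move=> a0 b0 s02 bL am; have /andP[s0 s2] := s02.
set w := expR _ * _; set D := hyper_total_bound b m.
have h0 : 0 < s / 2 by rewrite divr_gt0.
have w0 : 0 < w by rewrite /w !mulr_gt0 ?expR_gt0 ?powR_gt0.
have hs : s / 2 < s by lra.
have mh : measurable_fun [set: R] (EFin \o hyper_density fam a b).
  by apply/measurable_EFinP; exact: measurable_hyper_density.
set W := (\int[mu]_(x in `[(s / 2)%R, s]) (hyper_density fam a b x)%:E)%E.
have wW : ((s / 2 * w)%:E <= W)%E.
  apply: (@le_trans _ _ (\int[mu]_(z in `[(s / 2)%R, s]) (cst w%:E z))%E).
    rewrite integral_cst//= lebesgue_measure_itv/= lte_fin hs.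
    by rewrite -EFinB -EFinM lee_fin mulrC ler_wpM2l ?(ltW w0)//; lra.
  apply: ge0_le_integral => //.
  - by move=> z _; rewrite lee_fin ltW.
  - by apply/measurable_EFinP/measurable_funTS; exact: measurable_hyper_density.
  - move=> z /= zs; rewrite lee_fin /hyper_density patchE mem_set/=.
      by apply: hyper_fun_ge => //; move: zs; rewrite in_itv.
    by move: zs; rewrite !in_itv/= andbT => /andP[+ _]; exact: lt_le_trans.
have ZD := hyper_total_le fam a0 b0 am.
set Zt := (\int[mu]_x (hyper_density fam a b x)%:E)%E in ZD.
have WZ : (W <= Zt)%E.
  apply: ge0_subset_integral => // x _.
  by rewrite lee_fin hyper_density_ge0.
have W0 : (0 <= W)%E by apply: le_trans wW; rewrite lee_fin mulr_ge0 ?ltW.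
have ZE : Zt = (fine Zt)%:E.
  rewrite fineK// ge0_fin_numE ?(le_trans W0)//.
  by apply: le_lt_trans ZD _; rewrite ltry.
have WE : W = (fine W)%:E.
  rewrite fineK// ge0_fin_numE//.
  by apply: le_lt_trans WZ _; rewrite ZE ltry.
have Z0 : 0 < fine Zt.
  rewrite -lte_fin -ZE; apply: lt_le_trans WZ; apply: lt_le_trans wW.
  by rewrite lte_fin mulr_gt0.
rewrite /hyper_prob (proportionalE _ _ _ Z0 ZE) -/W WE -EFinM/=.
apply: ler_pM.
- by rewrite mulr_ge0 ?(ltW h0) ?(ltW w0).
- rewrite divr_ge0 ?(ltW a0)// mulr_ge0//.
  by rewrite /D /hyper_total_bound mulr_ge0// exprn_ge0// addr_ge0// invr_ge0 ltW.
- by rewrite -lee_fin -WE.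
- rewrite -[a / _]invrK invf_div lef_pV2 ?posrE//; last first.
    by move: ZD; rewrite ZE lee_fin; exact: lt_le_trans.
  by move: ZD; rewrite ZE lee_fin.
Qed.

End hyperprior_lower_bound.

Section integral_ge_cst.
Context (d : measure_display) (T : measurableType d) (R : realType).
Variable mu : {measure set T -> \bar R}.
Import HBNNSimple.

(* Stated for an arbitrary [f] so that the conditional probabilities in
   [is_lowrank_prior] can be bounded below without proving them measurable in
   the variances. *)
Lemma integral_ge_cst (D : set T) (f : T -> \bar R) (c : R) :
  measurable D -> 0 <= c -> (forall x, D x -> (c%:E <= f x)%E) ->
  (c%:E * mu D <= \int[mu]_(x in D) f x)%E.
Proof.
move=> mD c0 cf; pose h := scale_nnsfun (indic_nnsfun R mD) c0.
rewrite integral_mkcond ge0_integralTE; last first.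
  move=> x; apply: erestrict_ge0 => {}x /cf; apply: le_trans.
  by rewrite lee_fin.
apply: ereal_sup_ubound => /=; exists h.
  move=> x; rewrite (_ : h x = c * \1_D x)// patchE indicE.
  case: ifPn => xD; last by rewrite mulr0.
  by rewrite mulr1; apply: cf; exact: set_mem.
by rewrite (sintegralrM mu c (indic_nnsfun R mD)) sintegral_indic.
Qed.

End integral_ge_cst.

Section finite_cap.
Context (d : measure_display) (T : measurableType d).

Lemma measurable_forall (I : finType) (X : I -> set T) :
  (forall i, measurable (X i)) -> measurable [set x | forall i, X i x].
Proof.
move=> mX; rewrite (_ : mkset _ = \bigcap_(i in [set: I]) X i).
  exact: fin_bigcap_measurable.
by apply/seteqP; split => x Xx i => [_|]; exact: Xx.
Qed.

Lemma measurable_mx_box (d' : measure_display) (T' : measurableType d')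
    (m n : nat) (X : 'I_m -> 'I_n -> set T') (f : T -> 'M[T']_(m, n)) :
  (forall i j, measurable_fun [set: T] (fun x => f x i j)) ->
  (forall i j, measurable (X i j)) ->
  measurable [set x | forall i j, X i j (f x i j)].
Proof.
move=> mf mX; apply: (measurable_forall (X := fun i => _)) => i.
apply: (measurable_forall (X := fun j => _)) => j.
by rewrite -[X in measurable X]setTI; exact: mf.
Qed.

End finite_cap.

(** * Prior probability of a box of factors *)

Section prior_mass.
Context (R : realType) (fam : hyper_family) (a b : R) (d1 d2 K : nat).
Variable prior : probability 'M[R]_(d1, d2) R.

(** Given variances in the [G k], the factor entries are independent and column [k] lies in its box
    with probability at least [q k]. The independent variances contribute the hyperprior masses. *)
Lemma lowrank_prior_ge (G : 'I_K -> set R) (S : 'I_d1 -> 'I_K -> set R)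
    (S' : 'I_d2 -> 'I_K -> set R) (A : 'I_d1 -> 'I_d2 -> set R) (q : 'I_K -> R) :
  is_lowrank_prior fam a b K prior ->
  (forall k, measurable (G k)) -> (forall i k, measurable (S i k)) ->
  (forall j k, measurable (S' j k)) -> (forall i j, measurable (A i j)) ->
  (forall k, 0 <= q k) ->
  (forall k x, G k x ->
    q k <= (\prod_(i < d1) fine (normal_prob 0 (Num.sqrt x) (S i k))) *
           (\prod_(j < d2) fine (normal_prob 0 (Num.sqrt x) (S' j k)))) ->
  (forall (L : 'M[R]_(d1, K)) (Q : 'M[R]_(d2, K)),
    (forall i k, S i k (L i k)) -> (forall j k, S' j k (Q j k)) ->
    forall i j, A i j ((L *m Q^T) i j)) ->
  ((\prod_(k < K) (q k * fine (hyper_prob fam a b (G k))))%:E <=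
    prior [set M : 'M[R]_(d1, d2) | forall i j, A i j (M i j)])%E.
Proof.
move=> [d [W [P [g [L [Q [PG PS priorE]]]]]]] mG mS mS' mA q0 qP SA.
have mAM : measurable [set M : 'M[R]_(d1, d2) | forall i j, A i j (M i j)].
  apply: (measurable_mx_box (f := fun M : 'M[R]_(d1, d2) => M)) => // i j.
  exact: measurable_mx_entry.
rewrite priorE// /pushforward.
have mg k : measurable_fun [set: W] (fun w => g w ord0 k).
  exact: measurableT_comp (measurable_mx_entry _ _) _.
have mL i k : measurable_fun [set: W] (fun w => L w i k).
  exact: measurableT_comp (measurable_mx_entry _ _) _.
have mQ j k : measurable_fun [set: W] (fun w => Q w j k).
  exact: measurableT_comp (measurable_mx_entry _ _) _.
pose G' := [set v : 'rV[R]_K | forall k, G k (v ord0 k)].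
have mG' : measurable G'.
  apply: (measurable_forall (X := fun k => _)) => k.
  by rewrite -[X in measurable X]setTI; exact: measurable_mx_entry.
have mgG' : measurable (g @^-1` G').
  by rewrite -[X in measurable X]setTI; exact: measurable_funP.
apply: (@le_trans _ _ (P [set w | [/\ G' (g w), forall i k, S i k (L w i k)
    & forall j k, S' j k (Q w j k)]])); last first.
  apply: le_measure; rewrite ?inE.
  - rewrite (_ : mkset _ = g @^-1` G' `&` ([set w | forall i k, S i k (L w i k)]
        `&` [set w | forall j k, S' j k (Q w j k)])).
      by apply: measurableI => //; apply: measurableI; exact: measurable_mx_box.
    by apply/seteqP; split => w /= => [[? ? ?]|[? [? ?]]].
  - apply: (measurable_mx_box (f := fun w => L w *m (Q w)^T)) => // i j.
    under eq_fun do rewrite mxE.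
    apply: measurable_sum => k; under eq_fun do rewrite mxE.
    exact: measurable_funM.
  - by move=> w [_ Sw S'w] i j; exact: SA.
rewrite PS//; apply: le_trans (integral_ge_cst (c := \prod_k q k) _ _ _ _) => //.
- rewrite big_split/= EFinM
    [P _](_ : _ = (\prod_(k < K) fine (hyper_prob fam a b (G k)))%:E)//.
  exact: PG.
- exact: prodr_ge0.
- move=> w /= Gw; rewrite lee_fin.
  (* Exchanging the products groups together all entries that share the variance of column [k]. *)
  rewrite [X in X * _]exchange_big [X in _ * X]exchange_big -big_split/=.
  apply: ler_prod => k _; rewrite q0/=; apply: qP; exact: Gw.
Qed.

End prior_mass.

(** * Prior mass near the truth *)

(** Used with [x = ln (n d1 d2)], which is at least [ln 2]: any positive constant is then absorbed
    into a power of [n d1 d2]. *)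
Lemma expRN_le_cst (R : realType) (k : R) : 0 < k ->
  exists2 p : R, 0 <= p & forall x, ln 2 <= x -> expR (- (p * x)) <= k.
Proof.
move=> k0; have l2 : 0 < ln 2 :> R by rewrite ln_gt0// ltr1n.
exists (`|ln k| / ln 2) => [|x x2]; first by rewrite divr_ge0 ?(ltW l2).
rewrite -[leRHS]lnK ?posrE// ler_expR lerNl.
apply: (@le_trans _ _ `|ln k|); first by rewrite -normrN ler_norm.
by rewrite -mulrA ler_peMr// ler_pdivlMl// mulr1.
Qed.

Lemma onem_mulrn_le_exprn (R : realType) (y : R) (m : nat) : 0 <= y <= 1 ->
  1 - y *+ m <= (1 - y) ^+ m.
Proof.
move=> /andP[y0 y1]; elim: m => [|m ih]; first by rewrite subr0.
rewrite exprS (le_trans _ (ler_wpM2l _ ih)) ?subr_ge0// mulrS.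
have : 0 <= y * (y *+ m) by rewrite mulr_ge0// mulrn_wge0.
lra.
Qed.

Lemma exprn_onem_half (R : realType) (m : nat) : (0 < m)%N ->
  2^-1 <= (1 - (2 * m%:R)^-1) ^+ m :> R.
Proof.
move=> m0; have mR : 1 <= m%:R :> R by rewrite ler1n.
apply: le_trans (onem_mulrn_le_exprn _ _).
  rewrite -[_ *+ m]mulr_natr invfM -mulrA mulVf ?mulr1 ?gt_eqF//; lra.
rewrite invr_ge0 mulr_ge0//= invf_le1; lra.
Qed.

(** The interval has length [2 * c] and lies within distance [B + 1] of 0. The peak is at least
    [1 / 4] because [2 * pi * x <= 16]. *)
Lemma normal_prob_spread_ge (R : realType) (B c u x : R) :
  0 < c <= 1 -> `|u| <= B -> 1 <= x <= 2 ->
  c / 2 * expR (- ((B + 1) ^+ 2 / 2)) <=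
  fine (normal_prob 0 (Num.sqrt x) `[u - c, u + c]).
Proof.
move=> /andP[c0 c1] uB /andP[x1 x2]; have x0 : 0 < x by lra.
have s0 : Num.sqrt x != 0 by rewrite gt_eqF// sqrtr_gt0.
have uc : u - c <= u + c by lra.
apply: (le_trans _ (normal_prob_itv_ge (H := B + 1) s0 uc _)); last first.
  move=> z; move: uB; rewrite !ler_norml => /andP[? ?] /andP[? ?].
  by apply/andP; split; lra.
have peak : 4^-1 <= normal_peak (Num.sqrt x).
  rewrite /normal_peak sqr_sqrtr ?(ltW x0)// lef_pV2 ?posrE//; last first.
    by rewrite sqrtr_gt0 mulrn_wgt0// mulr_gt0 ?pi_gt0.
  rewrite -[leRHS]ger0_norm// -sqrtr_sqr ler_wsqrtr//.
  have pi4 : pi <= 4 :> R by have := @pihalf_lt2 R; lra.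
  by have := ler_pM (ltW x0) (@pi_ge0 R) x2 pi4; lra.
set E := expR (- (_ / (Num.sqrt x ^+ 2 *+ 2))).
rewrite (_ : _ * (_ * E) = c * (2 * normal_peak (Num.sqrt x)) * E); last by ring.
apply: ler_pM; rewrite ?expR_ge0 ?divr_ge0 ?(ltW c0)//.
  by rewrite ler_wpM2l ?(ltW c0)//; lra.
rewrite ler_expR lerN2 ler_wpM2l ?sqr_ge0// sqr_sqrtr ?(ltW x0)//.
by rewrite lef_pV2 ?posrE; lra.
Qed.

(** With [x] a logarithm, this says that polynomially small [s] and [b] give polynomially small
    mass, with an exponent uniform in the family, [b] and [s]. *)
Lemma hyper_prob_poly_ge (R : realType) (a L k1 k2 e1 e2 : R) :
  0 < a -> 0 < k1 -> 0 < k2 -> 0 <= e1 -> 0 <= e2 ->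
  exists2 p : R, 0 <= p & forall fam b s x,
    ln 2 <= x -> 0 < b -> 0 < s <= 2 -> b <= L * s ->
    k1 * expR (- (e1 * x)) <= s / 2 -> k2 * expR (- (e2 * x)) <= b ->
    expR (- (p * x)) <= fine (hyper_prob fam a b `[s / 2, s]).
Proof.
move=> a0 k10 k20 e10 e20; pose m := Num.bound (2 * a).
have am : 2 * a <= m.+1%:R.
  apply: ltW; apply: lt_le_trans (_ : m%:R <= _); last by rewrite ler_nat.
  by rewrite archi_boundP// mulr_ge0// ltW.
have [p1 p10 p1P] := expRN_le_cst k10.
have f0 : 0 < m.+1`!%:R :> R by rewrite ltr0n fact_gt0.
pose C : R := expR (- (4 * L)) * (2 `^ (- a) / 2) * (a / (2 * m.+1`!%:R)).
have C0 : 0 < C by rewrite /C !mulr_gt0 ?expR_gt0 ?powR_gt0 ?invr_gt0 ?mulr_gt0.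
have [p2 p20 p2P] := expRN_le_cst C0.
have k30 : 0 < (1 + k2^-1)^-1 by rewrite invr_gt0 addr_gt0 ?invr_gt0.
have [p3 p30 p3P] := expRN_le_cst k30.
(* The four summands pay for [s / 2], its power [a], the constant [C], and the factor
   [(1 + b^-1) ^- m.+1]. *)
exists ((p1 + e1) + (p1 + e1) * a + p2 + m.+1%:R * (p3 + e2)) =>
  [|fam b s x x2 b0 s02 bL sx bx].
  by rewrite !addr_ge0 ?mulr_ge0 ?addr_ge0// ltW.
have l2 : 0 <= ln 2 :> R by rewrite ln_ge0// ler1n.
have x0 : 0 <= x := le_trans l2 x2.
have /andP[s0 s2] := s02.
apply: le_trans (hyper_prob_ge fam a0 b0 s02 bL am).
have y1 : expR (- ((p1 + e1) * x)) <= s / 2.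
  apply: le_trans sx; rewrite mulrDl opprD expRD ler_wpM2r ?expR_ge0//.
  exact: p1P.
have y2 : expR (- ((p1 + e1) * a * x)) <= (s / 2) `^ a.
  rewrite mulrAC -mulNr expRM ge0_ler_powR ?nnegrE ?expR_ge0 ?(ltW a0)//.
  by rewrite divr_ge0 ?(ltW s0).
have y3 : expR (- ((p3 + e2) * x)) <= (1 + b^-1)^-1.
  apply: (@le_trans _ _ ((1 + k2^-1)^-1 * expR (- (e2 * x)))).
    by rewrite mulrDl opprD expRD ler_wpM2r ?expR_ge0// p3P.
  rewrite expRN -invfM lef_pV2 ?posrE ?mulr_gt0 ?expR_gt0 ?addr_gt0 ?invr_gt0//.
  rewrite mulrDl mul1r lerD//.
    by rewrite -[leLHS]expR0 ler_expR mulr_ge0.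
  rewrite -[leRHS]invrK lef_pV2 ?posrE ?invr_gt0 ?mulr_gt0 ?invr_gt0 ?expR_gt0//.
  by rewrite invfM invrK -expRN.
have y4 : expR (- (m.+1%:R * (p3 + e2) * x)) <= (1 + b^-1) ^- m.+1.
  rewrite -mulrA -mulrN expRM_natl -exprVn lerXn2r ?nnegrE ?expR_ge0//.
  by rewrite invr_ge0 addr_ge0 ?invr_ge0 ?(ltW b0).
rewrite [leRHS](_ : _ = (s / 2) * (s / 2) `^ a * C * (1 + b^-1) ^- m.+1); last first.
  have : (1 + b^-1) ^+ m.+1 != 0.
    by rewrite expf_neq0// gt_eqF// addr_gt0// invr_gt0.
  rewrite /C /hyper_total_bound; move: (_ ^+ _) f0 => v f0 v0.
  by field; rewrite v0 gt_eqF.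
rewrite (_ : - _ = - ((p1 + e1) * x) + - ((p1 + e1) * a * x) + - (p2 * x) +
  - (m.+1%:R * (p3 + e2) * x)); last by ring.
rewrite !expRD !ler_pM ?mulr_ge0 ?expR_ge0//.
exact: p2P.
Qed.

Lemma ler_prod_const (R : realType) (m : nat) (e : R) (F : 'I_m -> R) :
  0 <= e -> (forall i, e <= F i) -> e ^+ m <= \prod_i F i.
Proof.
move=> e0 eF; rewrite -[in leLHS](card_ord m) -prodr_const.
by apply: ler_prod => i _; rewrite e0 eF.
Qed.

Lemma sum_ord_lt (K r m : nat) : (r <= K)%N ->
  (\sum_(k < K) (if k < r then m else 0) = r * m)%N.
Proof.
move=> rK; rewrite -big_mkcond/= -(big_ord_widen K (fun=> m) rK).
by rewrite sum_nat_const card_ord.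
Qed.

(** Each of the [K] terms differs by a product of two errors and two mixed terms, at most
    [c + c * B + B * c] as [c <= 1]. *)
Lemma factorization_close (R : realType) (d1 d2 K : nat) (B c e : R)
    (U L : 'M[R]_(d1, K)) (V Q : 'M[R]_(d2, K)) (i : 'I_d1) (j : 'I_d2) :
  0 <= c <= 1 -> K%:R * (c * (2 * B + 1)) <= e ->
  (forall i k, `|U i k| <= B) -> (forall j k, `|V j k| <= B) ->
  (forall i k, `|L i k - U i k| <= c) -> (forall j k, `|Q j k - V j k| <= c) ->
  `|(L *m Q^T) i j - (U *m V^T) i j| <= e.
Proof.
move=> /andP[c0 c1] Kc UB VB LU QV; apply: le_trans Kc.
rewrite !mxE -sumrB (le_trans (ler_norm_sum _ _ _))//.
rewrite mulr_natl -[in leRHS](card_ord K) -sumr_const ler_sum// => k _.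
rewrite !mxE (_ : _ - _ = (L i k - U i k) * (Q j k - V j k) +
  (L i k - U i k) * V j k + U i k * (Q j k - V j k)); last by ring.
rewrite (le_trans (ler_normD _ _))// (_ : c * _ = c * 1 + c * B + B * c); last by ring.
rewrite lerD//; last by rewrite normrM ler_pM.
rewrite (le_trans (ler_normD _ _))// lerD// normrM ler_pM//.
by rewrite (le_trans (QV _ _)).
Qed.

Lemma prior_near_truth (R : realType) (a B : R) : 0 < a -> 0 < B ->
  exists2 p : R, 0 <= p & forall fam (n d1 d2 K r : nat)
    (U : 'M[R]_(d1, K)) (V : 'M[R]_(d2, K)) prior,
  (1 <= K <= minn d1 d2)%N -> (1 <= r <= K)%N -> (1 < n * d1 * d2)%N ->
  bounded_factors r B U V ->
  is_lowrank_prior fam a (B ^+ 2 / (512%:R * (n * d1 * d2)%:R ^+ 4 *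
    K%:R ^+ 2 * (maxn d1 d2)%:R ^+ 2)) K prior ->
  ((expR (- (p * ((r * (d1 + d2))%:R * ln (n * d1 * d2)%:R))))%:E <=
   prior [set M : 'M[R]_(d1, d2) |
     forall i j, (`|M i j - (U *m V^T) i j| <= n%:R^-1)%R])%E.
Proof.
move=> a0 B0; pose B1 := 2 * B + 1.
have B10 : 0 < B1 by rewrite /B1; lra.
pose k1 := (64 * B1 ^+ 2)^-1; pose k2 := B ^+ 2 / 512.
have k10 : 0 < k1 by rewrite invr_gt0 mulr_gt0// exprn_gt0.
have k20 : 0 < k2 by apply: divr_gt0; [exact: exprn_gt0|rewrite ltr0n].
(* Chosen to give [b <= L * t] below. In the next line, 3 and 8 are the powers of [N^-1] in the
   lower bounds for [t / 2] and [b]. *)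
pose L := B ^+ 2 * (B1 ^+ 2 + 1).
have [p1 p10 p1P] := hyper_prob_poly_ge L a0 k10 k20 (ler0n R 3) (ler0n R 8).
pose k4 := B1^-1 / 2 * expR (- ((B + 1) ^+ 2 / 2)).
have k40 : 0 < k4 by rewrite mulr_gt0 ?expR_gt0// divr_gt0// invr_gt0.
have [p4 p40 p4P] := expRN_le_cst k40.
(* Each entry of an active column costs [p4 + 1]: a constant and the width [c]. Each column costs a
   further [1 + p1]: a factor 1/2 and the hyperprior mass. *)
exists (p4 + 1 + (1 + p1)) => [|fam n d1 d2 K r U V prior]; first lra.
move=> /andP[K1]; rewrite leq_min => /andP[Kd1 Kd2] /andP[r1 rK] N1 [UB VB Ur Vr].
set N := (n * d1 * d2)%N in N1 *; set m := (d1 + d2)%N.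
set x := maxn d1 d2; set b := B ^+ 2 / _ => priorP.
have [n0 d10 d20] : [/\ (0 < n)%N, (0 < d1)%N & (0 < d2)%N].
  by move: N1; rewrite /N; case: (n) (d1) (d2) => [|?] [|?] [|?]; rewrite ?muln0.
have N0 : (0 < N)%N by exact: ltnW.
have nKN : (n * K <= N)%N.
  by rewrite (leq_trans (leq_mul (leqnn n) Kd1))// leq_pmulr.
have d1N : (d1 <= N)%N by exact: leq_trans (leq_pmull _ n0) (leq_pmulr _ d20).
have d2N : (d2 <= N)%N by rewrite leq_pmull// muln_gt0 n0.
have xN : (x <= N)%N by rewrite geq_max d1N.
have x0 : (0 < x)%N by rewrite leq_max d10.
have m0 : (0 < m)%N by rewrite addn_gt0 d10.
have mx : (m <= 2 * x)%N by rewrite mul2n -addnn leq_add// leq_max leqnn ?orbT.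
have KN : (K <= N)%N by exact: leq_trans d1N.
clearbody N.
(* The integer factors of the denominators: [t] will be [1 / (16 * B1^2 * T)] and [b] is
   [B^2 / Q]. *)
pose T := (m * (n * K) ^ 2)%N; pose Q := (512 * N ^ 4 * K ^ 2 * x ^ 2)%N.
have T0 : (0 < T)%N by rewrite /T muln_gt0 m0/= expn_gt0 muln_gt0 n0 K1.
have Q0 : (0 < Q)%N by rewrite /Q !muln_gt0 N0 K1 x0.
have T3 : (T <= 2 * N ^ 3)%N.
  rewrite (expnS N 2) mulnA leq_mul ?leq_exp2r//.
  by rewrite (leq_trans mx)// leq_mul2l.
have TQ : (16 * T <= Q)%N.
  rewrite /T /Q expnMn.
  rewrite (_ : 512 * _ * _ * _ = 512 * x ^ 2 * (N ^ 4 * K ^ 2))%N; last by ring.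
  rewrite [leqLHS]mulnA; apply: leq_mul.
    rewrite (leq_trans (leq_mul (leqnn 16) mx))// mulnA leq_mul//.
    by rewrite -{1}(expn1 x) leq_pexp2l.
  apply: leq_mul => //; apply: (@leq_trans (N ^ 2)); last by rewrite leq_pexp2l.
  by rewrite leq_exp2r// (leq_trans _ nKN)// leq_pmulr.
have QN : (Q <= 512 * N ^ 8)%N.
  rewrite /Q (_ : (8 = 4 + 2 + 2)%N)// !expnD !mulnA.
  by rewrite !leq_mul ?leq_exp2r.
have bE : b = B ^+ 2 / Q%:R by rewrite /b /Q 3!natrM !natrX.
clearbody Q.
have [nR KR] : 0 < n%:R :> R /\ 0 < K%:R :> R by rewrite !ltr0n.
have NR : 0 < N%:R :> R by rewrite ltr0n.
have mR : 0 < m%:R :> R by rewrite ltr0n.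
have TR : 0 < T%:R :> R by rewrite ltr0n.
have QR : 0 < Q%:R :> R by rewrite ltr0n.
pose y : R := ln N%:R.
have y2 : ln 2 <= y by rewrite ler_ln ?posrE// ler_nat.
have l2 : 0 < ln 2 :> R by rewrite ln_gt0// ltr1n.
have y0 : 0 <= y by exact: le_trans (ltW l2) y2.
have expNy q : expR (- (q%:R * y)) = (N%:R ^+ q)^-1.
  by rewrite expRN expRM_natl lnK ?posrE.
have b0 : 0 < b by rewrite bE divr_gt0// exprn_gt0.
have bN : k2 * expR (- (8%:R * y)) <= b.
  rewrite expNy bE /k2 -mulrA ler_pM2l ?exprn_gt0//.
  rewrite -invfM lef_pV2; first by rewrite -natrX -natrM ler_nat.
    by rewrite posrE; apply: mulr_gt0; [rewrite ltr0n|exact: exprn_gt0].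
  by rewrite posrE.
(* With this width the bound [K * (c * B1)] of [factorization_close] equals [1 / n]. *)
pose c : R := (B1 * (n * K)%:R)^-1.
have nKR : 1 <= (n * K)%:R :> R by rewrite ler1n muln_gt0 n0.
have B11 : 1 < B1 by rewrite ltrDr mulr_gt0.
have c0 : 0 < c by rewrite invr_gt0 mulr_gt0// (lt_le_trans _ nKR).
have c1 : c <= 1.
  rewrite invf_le1; last by rewrite mulr_gt0// (lt_le_trans _ nKR).
  by rewrite mulr_ege1// ltW.
(* Variance at most [t] makes the failure probability of an entry at most
   [8 * t / c^2 = 1 / (2 * m)], so [exprn_onem_half] covers all [m] entries of a column. *)
pose t : R := c ^+ 2 / (16 * m%:R).
have tE : t = (16 * (B1 ^+ 2 * T%:R))^-1.
  rewrite /t /c /T (natrM _ m) natrX; field.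
  by rewrite !gt_eqF// (lt_le_trans _ nKR).
clearbody T.
have t0 : 0 < t by rewrite divr_gt0 ?exprn_gt0// mulr_gt0.
have t1 : t <= 1.
  rewrite /t ler_pdivrMr ?mul1r ?mulr_gt0//.
  have : 1 <= m%:R :> R by rewrite ler1n.
  have : c ^+ 2 <= 1 by rewrite exprn_ile1// ltW.
  lra.
have tN : k1 * expR (- (3%:R * y)) <= t / 2.
  rewrite expNy tE /k1 -!invfM lef_pV2 ?posrE ?mulr_gt0 ?exprn_gt0//.
  rewrite -natrX.
  have : T%:R <= 2 * (N ^ 3)%:R :> R by rewrite -natrM ler_nat.
  have B12 : 0 < B1 ^+ 2 by rewrite exprn_gt0.
  by rewrite -(ler_pM2l B12); lra.
have bt : b <= L * t.
  have B12 : 0 < B1 ^+ 2 by rewrite exprn_gt0.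
  rewrite bE tE /L.
  rewrite [leRHS](_ : _ = B ^+ 2 * ((16 * T%:R)^-1 * (1 + (B1 ^+ 2)^-1))); last first.
    by field; rewrite !gt_eqF.
  rewrite ler_pM2l ?exprn_gt0// -[leLHS]mulr1 ler_pM ?invr_ge0 ?(ltW QR)//.
    by rewrite lef_pV2 ?posrE ?mulr_gt0// -natrM ler_nat.
  by rewrite lerDl invr_ge0 ltW.
pose s (k : 'I_K) : R := if (k < r)%N then 2 else t.
have s0 k : 0 < s k <= 2.
  by rewrite /s; case: ifP => _; rewrite ?ltr0n ?lexx// t0 (le_trans t1) ?ler1n.
have bs k : b <= L * s k.
  rewrite /s; case: ifP => _ //; apply: (le_trans bt).
  apply: ler_wpM2l; last by rewrite (le_trans t1)// ler1n.
  by rewrite /L mulr_ge0 ?addr_ge0 ?sqr_ge0.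
have sN k : k1 * expR (- (3%:R * y)) <= s k / 2.
  by apply: (le_trans tN); rewrite /s; case: ifP => _ //; lra.
pose G k : set R := `[s k / 2, s k].
pose S (i : 'I_d1) (k : 'I_K) : set R := `[U i k - c, U i k + c].
pose S' (j : 'I_d2) (k : 'I_K) : set R := `[V j k - c, V j k + c].
pose A (i : 'I_d1) (j : 'I_d2) : set R :=
  `[(U *m V^T) i j - n%:R^-1, (U *m V^T) i j + n%:R^-1].
pose q (k : 'I_K) : R :=
  if (k < r)%N then expR (- ((p4 + 1) * y)) ^+ m else 2^-1.
have q0 k : 0 <= q k.
  by rewrite /q; case: ifP => _; rewrite ?invr_ge0// exprn_ge0// expR_ge0.
have SA (L' : 'M[R]_(d1, K)) (Q' : 'M[R]_(d2, K)) :
    (forall i k, S i k (L' i k)) -> (forall j k, S' j k (Q' j k)) ->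
    forall i j, A i j ((L' *m Q'^T) i j).
  move=> SL SQ i j; rewrite /A/= in_itv/= -ler_distl.
  apply: (factorization_close (B := B) (c := c)) => //.
  + by rewrite (ltW c0).
  + rewrite -/B1 /c natrM le_eqVlt; apply/orP; left; apply/eqP.
    by field; rewrite !gt_eqF.
  + by move=> i' k; have := SL i' k; rewrite /S/= in_itv/= ler_distl.
  + by move=> i' k; have := SQ i' k; rewrite /S'/= in_itv/= ler_distl.
have entry_ge u z : `|u| <= B -> 1 <= z <= 2 ->
    expR (- ((p4 + 1) * y)) <= fine (normal_prob 0 (Num.sqrt z) `[u - c, u + c]).
  move=> uB z12.
  apply: le_trans (normal_prob_spread_ge _ uB z12); last by rewrite c0.
  rewrite mulrDl opprD expRD.
  apply: (@le_trans _ _ (k4 * expR (- (1 * y)))).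
    by rewrite ler_wpM2r ?expR_ge0// p4P.
  rewrite (expNy 1%N) expr1 /k4 mulrAC ler_wpM2r ?expR_ge0// mulrAC ler_wpM2r//.
  rewrite -invfM lef_pV2 ?posrE ?mulr_gt0 ?ltr0n ?muln_gt0 ?n0//.
  by rewrite ler_wpM2l ?ler_nat// ltW.
have small_ge z : t / 2 <= z <= t ->
    1 - (2 * m%:R)^-1 <= fine (normal_prob 0 (Num.sqrt z) `[0 - c, 0 + c]).
  move=> /andP[tz zt]; have z0 : 0 < z by lra.
  rewrite sub0r add0r; apply: le_trans (normal_prob_centered_ge _ c0); last first.
    by rewrite gt_eqF// sqrtr_gt0.
  rewrite sqr_sqrtr ?(ltW z0)// lerB//.
  rewrite ler_pdivrMr ?exprn_gt0//.
  apply: (@le_trans _ _ (8 * t)); first by rewrite ler_pM2l.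
  by rewrite /t le_eqVlt; apply/orP; left; apply/eqP; field; rewrite gt_eqF.
have qP k z : G k z ->
    q k <= (\prod_(i < d1) fine (normal_prob 0 (Num.sqrt z) (S i k))) *
           (\prod_(j < d2) fine (normal_prob 0 (Num.sqrt z) (S' j k))).
  rewrite /G/= in_itv/= /s /q; case: ifPn => kr zG.
    rewrite divff// in zG.
    rewrite exprD ler_pM ?exprn_ge0 ?expR_ge0// ler_prod_const ?expR_ge0// => i.
      exact: entry_ge.
    exact: entry_ge.
  have m1 : (2 * m%:R)^-1 <= 1 :> R.
    by rewrite invf_le1 ?mulr_gt0// -natrM ler1n muln_gt0.
  apply: (le_trans (exprn_onem_half R m0)).
  rewrite exprD ler_pM ?exprn_ge0 ?subr_ge0// ler_prod_const ?subr_ge0// => i.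
    by rewrite /S Ur ?small_ge// leqNgt.
  by rewrite /S' Vr ?small_ge// leqNgt.
have qH (k : 'I_K) :
    expR (- ((p4 + 1) * y * (if (k < r)%N then m else 0%N)%:R + (1 + p1) * y))
    <= q k * fine (hyper_prob fam a b (G k)).
  rewrite (_ : - _ = - ((p4 + 1) * y * (if (k < r)%N then m else 0%N)%:R) - y +
    - (p1 * y)); last by ring.
  rewrite expRD ler_pM ?expR_ge0//; last first.
    by apply: p1P => //; exact: s0.
  rewrite /q; case: ifP => _.
    rewrite -expRM_natr mulNr -[leRHS]mulr1 expRD ler_wpM2l ?expR_ge0//.
    by rewrite expR_le1 oppr_le0.
  (* Beyond column [r], the extra factor [expR (- y) = 1 / N] lies below [q k = 1 / 2]. *)
  rewrite mulr0 oppr0 add0r expRN lef_pV2 ?posrE ?expR_gt0//.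
  by rewrite lnK ?posrE// ler_nat.
have prior_ge := lowrank_prior_ge priorP (fun k => measurable_itv _)
  (fun i k => measurable_itv _) (fun j k => measurable_itv _)
  (fun i j => measurable_itv _) q0 qP SA.
rewrite (_ : [set M | _] =
    [set M : 'M[R]_(d1, d2) | forall i j, A i j (M i j)]); last first.
  by apply/seteqP; split => M AM i j; move: (AM i j); rewrite /A/= in_itv/= ler_distl.
apply: le_trans prior_ge; rewrite lee_fin.
apply: (@le_trans _ _ (\prod_(k < K)
  expR (- ((p4 + 1) * y * (if (k < r)%N then m else 0%N)%:R +
    (1 + p1) * y)))); last first.
  by apply: ler_prod => k _; rewrite expR_ge0 qH.
rewrite -expR_sum ler_expR sumrN lerN2 big_split/= -mulr_sumr -natr_sum.
rewrite sum_ord_lt// sumr_const card_ord.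
rewrite -/m -/y [leRHS]mulrDl.
rewrite lerD//; first by rewrite mulrAC mulrA.
(* The [K] per-column costs fit because [K <= d1 <= r * (d1 + d2)]. *)
rewrite -[leLHS]mulr_natr -mulrA ler_wpM2l ?addr_ge0// mulrC ler_wpM2r// ler_nat.
rewrite (leq_trans Kd1)// (leq_trans (leq_addr d2 d1))// leq_pmull//.
Qed.

(** * Risk bound with the explicit hyperparameter *)

Theorem theorem1 (R : realType) (a B : R) (a_gt0 : 0 < a) (B_gt0 : 0 < B) :
  exists C : R, 0 < C /\
  forall (fam : hyper_family) (n d1 d2 K r : nat)
    (Pi : 'I_d1 * 'I_d2 -> R) (alpha : R)
    (U : 'M[R]_(d1, K)) (V : 'M[R]_(d2, K)),
  (1 <= K <= minn d1 d2)%N -> (1 <= r <= K)%N -> (1 < n * d1 * d2)%N ->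
  is_pmf Pi -> 0 < alpha < 1 -> bounded_factors r B U V ->
  let Mstar := U *m V^T in
  let eps := C * ((r * (d1 + d2))%:R * ln (n * d1 * d2)%:R / n%:R) in
  let bound_holds (b : R) :=
    forall prior : probability 'M[R]_(d1, d2) R,
      is_lowrank_prior fam a b K prior ->
      (expected_risk alpha Pi Mstar prior n
         <= ((1 + alpha) / (1 - alpha) * eps)%:E)%E in
  (exists b : R, 0 < b /\ bound_holds b) /\
  bound_holds (B ^+ 2 /
    (512%:R * (n * d1 * d2)%:R ^+ 4 * K%:R ^+ 2 * (maxn d1 d2)%:R ^+ 2)).
Proof.
have [p p0 priorP] := prior_near_truth a_gt0 B_gt0.
have l2 : 0 < ln 2 :> R by rewrite ln_gt0// ltr1n.
have l2V : 0 < (ln 2)^-1 :> R by rewrite invr_gt0.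
(* The part [(ln 2)^-1] absorbs the additive [alpha] of [expected_risk_le], since
   [r (d1 + d2) ln (n d1 d2)] is at least [ln 2]. *)
exists (p + (ln 2)^-1); split; first by rewrite ltr_wpDl.
move=> fam n d1 d2 K r Pi alpha U V hK hr hN hPi halpha hUV Mstar eps bound_holds.
set b := B ^+ 2 / _.
have n0 : (0 < n)%N by move: hN; case: (n).
have m1 : (1 <= r * (d1 + d2))%N.
  move: hK hr => /andP[K1]; rewrite leq_min => /andP[Kd1 _] /andP[r1 _].
  by rewrite muln_gt0 r1 addn_gt0 (leq_trans K1 Kd1).
have bP : bound_holds b.
  move=> prior hprior; have /andP[al0 al1] := halpha.
  have prior_ge := priorP _ _ _ _ _ _ _ _ _ hK hr hN hUV hprior.
  apply: (le_trans (expected_risk_le hPi halpha n0 (expR_gt0 _) prior_ge)).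
  rewrite lee_fin expRK opprK /eps.
  set X : R := _%:R * ln _.
  have X2 : ln 2 <= X.
    rewrite -[leLHS]mul1r ler_pM ?(ltW l2) ?ler1n//.
    by rewrite ler_ln ?posrE ?ltr0n ?ler_nat// (ltn_trans _ hN).
  have nR : 0 < n%:R :> R by rewrite ltr0n.
  have X1 : 1 <= (ln 2)^-1 * X by rewrite ler_pdivlMl// mulr1.
  have X0 : 0 <= X by lra.
  have pX0 : 0 <= p * X by rewrite mulr_ge0.
  rewrite [leRHS](_ : _ = (1 + alpha) * ((p + (ln 2)^-1) * X) /
    (n%:R * (1 - alpha))); last first.
    by field; rewrite !gt_eqF// subr_gt0.
  rewrite ler_wpM2r ?invr_ge0 ?mulr_ge0 ?subr_ge0 ?(ltW al1)//.
  have := mulr_ge0 (ltW al0) pX0.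
  have : alpha <= alpha * ((ln 2)^-1 * X) by rewrite ler_peMr// ltW.
  lra.
split; last exact: bP.
exists b; split=> //; move: hK => /andP[K1]; rewrite leq_min => /andP[Kd1 _].
apply: divr_gt0; first exact: exprn_gt0.
apply: mulr_gt0; last by rewrite exprn_gt0// ltr0n leq_max (leq_trans K1 Kd1).
apply: mulr_gt0; last by rewrite exprn_gt0// ltr0n.
apply: mulr_gt0; first by rewrite ltr0n.
by rewrite exprn_gt0// ltr0n ltnW.
Qed.
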